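(* Let $f:M\to\mathbb{R}^{m+1}$ be a locally strongly convex hypersurface with affine shape operator $S$, and let $(h,\nabla)$ be the statistical structure on $M$ equiaffinely induced by $f$. Consider $f$ as a map from the statistical manifold $(M,h,\nabla)$ to the statistical manifold $(\mathbb{R}^{m+1},g_0,\nabla^{g_0})$, where $g_0$ is a Euclidean metric compatible with the equiaffine structure of $\mathbb{R}^{m+1}$. Then $\tau(f)$ does not vanish (i.e. $\tau(f)$ is non-zero at every point of $M$). Moreover, $f$ is statistical biharmonic if and only if both (1) $\mathrm{tr}\,S=0$ and (2) $\mathrm{tr}_h\nabla S=0$ hold. In particular, an improper affine hypersphere (that is, a locally strongly convex hypersurface $f$ with $S=0$) is a statistical biharmonic map.
   Context: All objects are smooth; $M$ has dimension $m\ge2$; $\Gamma(E)$ denotes the smooth sections of $E$. Statistical manifolds. A statistical manifold $(M,g,\nabla)$ is a Riemannian manifold $(M,g)$ with a torsion-free affine connection $\nabla$ such that $(\nabla_Xg)(Y,Z)=(\nabla_Yg)(X,Z)$ for all vector fields $X,Y,Z$. Write $\nabla^g$ for the Levi-Civita connection of $g$, $K(X,Y)=\nabla_XY-\nabla^g_XY$, and $\overline{\nabla}$ for the conjugate connection, defined by $Xg(Y,Z)=g(\nabla_XY,Z)+g(Y,\overline{\nabla}_XZ)$. The curvature is $R(X,Y)Z=\nabla_X\nabla_YZ-\nabla_Y\nabla_XZ-\nabla_{[X,Y]}Z$, and the curvature interchange tensor field $L$ is defined by $g(L(Z,W)X,Y)=g(R(X,Y)Z,W)$. Statistical biharmonic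 maps. For a smooth map $u:(M,g,\nabla^M)\to(N,k,\nabla^N)$ between statistical manifolds, let $\nabla^u$, $\overline{\nabla}^u$ be the connections on $u^{-1}TN$ induced by $u$ from $\nabla^N$ and from its conjugate $\overline{\nabla}^N$ with respect to $k$. With $\{e_i\}$ a local $g$-orthonormal frame of $M$, put $$\tau(u)=\sum_{i=1}^m\left(\nabla^u_{e_i}(u_*e_i)-u_*\nabla^M_{e_i}e_i\right),\qquad \bar{\Delta}^u\xi=\sum_{i=1}^m\left(\overline{\nabla}^u_{e_i}\overline{\nabla}^u_{e_i}\xi-\overline{\nabla}^u_{\overline{\nabla}^M_{e_i}e_i}\xi\right),$$ $$\tau_2(u)=\bar{\Delta}^u\tau(u)+\operatorname{div}^g(\mathrm{tr}_gK^M)\,\tau(u)-\sum_{i=1}^mL^N(u_*e_i,\tau(u))u_*e_i-K^N(\tau(u),\tau(u)),$$ where $\mathrm{tr}_gK^M=\sum_iK^M(e_i,e_i)$ and $\operatorname{div}^gX=\mathrm{tr}(\nabla^gX)$. The map $u$ is called statistical biharmonic if $\tau_2(u)=0$ identically. Equiaffine geometry. Let $D$ be the standard flat affine connection and $\det$ the standard volume form of $\mathbb{R}^{m+1}$. A Euclidean metric $g_0$ on $\mathbb{R}^{m+1}$ is compatible with this equiaffine structure if its Levi-Civita connection is $D$ and its volume form is $\det$; then $(g_0,\nabla^{g_0})=(g_0,D)$ is a statistical structure. For a locally strongly convex hypersurface (immersion) $f:M\to\mathbb{R}^{m+1}$, the Blaschke normal vector field $\xi\in\Gamma(f^{-1}T\mathbb{R}^{m+1})$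 is the transversal vector field such that in the decomposition, for $X,Y\in\Gamma(TM)$, $$D_Xf_*Y=f_*\nabla_XY+h(X,Y)\xi,\qquad D_X\xi=-f_*SX+\theta(X)\xi,$$ (1) the one-form $\theta$ vanishes and $h$ is a Riemannian metric on $M$, and (2) $d\mu_h(X_1,\dots,X_m)=\det(f_*X_1,\dots,f_*X_m,\xi)$ for $X_1,\dots,X_m\in\Gamma(TM)$, where $d\mu_h$ is the Riemannian volume form of $h$ for the orientation of $M$ making the right-hand side positive on positively oriented frames. The metric $h$ is the Blaschke metric, the $(1,1)$-tensor field $S$ is the affine shape operator, and $(h,\nabla)$ is the statistical structure equiaffinely induced by $f$. Finally $\mathrm{tr}_h\nabla S=\sum_{i=1}^m(\nabla_{e_i}S)e_i\in\Gamma(TM)$ for a local $h$-orthonormal frame $\{e_i\}$. *)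

(* Defs.v *)
From HB Require Import structures.
From mathcomp Require Import all_boot all_order all_algebra.
From mathcomp Require Import all_classical all_reals all_analysis.

Set Implicit Arguments.
Unset Strict Implicit.
Unset Printing Implicit Defensive.
Import Order.TTheory GRing.Theory Num.Theory.
Import numFieldNormedType.Exports.
Local Open Scope classical_set_scope.
Local Open Scope ring_scope.

(* Conventions.  Vectors are row vectors; a matrix S : 'M_m encodes the         *)
(* endomorphism v |-> v *m S and G : 'M_m the bilinear form v *m G *m w^T.      *)
(* Geometric objects on a manifold are given, as in classical tensor calculus,  *)
(* by their components in every chart, subject to the transformation law under  *)
(* changes of charts.  The components are functions on the whole of R^m, but    *)
(* only their values on the image of the chart are meaningful.                  *)

(* Meant for open A: class C^k, then class C^oo. *)
Fixpoint class_C (R : realType) (m : nat) (W : normedModType R) (k : nat)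
    (A : set 'rV[R]_m) (F : 'rV[R]_m -> W) : Prop :=
  match k with
  | 0%N => forall x, A x -> {for x, continuous F}
  | k'.+1 => (forall x, A x -> differentiable F x) /\
             forall v, class_C k' A ('D_v F)
  end.

Definition smooth_on (R : realType) (m : nat) (W : normedModType R)
    (A : set 'rV[R]_m) (F : 'rV[R]_m -> W) : Prop :=
  forall k, class_C k A F.

Lemma class_C_cst (R : realType) m (W : normedModType R) k (A : set 'rV[R]_m)
  (w : W) : class_C k A (cst w).
Proof.
elim: k w => [|k IH] w /=; first by move=> x _; exact: cst_continuous.
split=> [x _|v]; first exact: differentiable_cst.
rewrite (_ : 'D_v (cst w) = cst 0) //.
by apply/funext => x; exact: derive_cst.
Qed.

Lemma smooth_on_cst (R : realType) m (W : normedModType R) (A : set 'rV[R]_m)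
  (w : W) : smooth_on A (cst w).
Proof. by move=> k; exact: class_C_cst. Qed.

Lemma derive_idE (R : realType) m (v : 'rV[R]_m) :
  'D_v (id : 'rV[R]_m -> 'rV[R]_m) = cst v.
Proof. by apply/funext => x; exact: derive_id. Qed.

Lemma smooth_on_id (R : realType) m (A : set 'rV[R]_m) :
  smooth_on A (id : 'rV[R]_m -> 'rV[R]_m).
Proof.
case=> [|k] /=; first by move=> x _; exact: cvg_id.
split=> [x _|v]; first by apply: ex_diff; exact: is_diff_id.
by rewrite derive_idE; exact: class_C_cst.
Qed.

Record chart (R : realType) (m : nat) (M : topologicalType) := Chart {
  cdom : set M ;
  coord : M -> 'rV[R]_m ;
  param : 'rV[R]_m -> M ;
  cimg := coord @` cdom ;
  cdom_open : open cdom ;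
  cimg_open : open cimg ;
  coordK : forall p, cdom p -> param (coord p) = p ;
  coord_continuous : forall p, cdom p -> {for p, continuous coord} ;
  param_continuous : forall x, cimg x -> {for x, continuous param} }.

Definition transition (R : realType) (m : nat) (M : topologicalType)
  (c d : chart R m M) : 'rV[R]_m -> 'rV[R]_m := coord d \o param c.

Definition overlap (R : realType) (m : nat) (M : topologicalType)
  (c d : chart R m M) : set 'rV[R]_m :=
  [set x | cimg c x /\ cdom d (param c x)].

Record manifold (R : realType) (m : nat) := Manifold {
  points :> topologicalType ;
  index : Type ;
  atlas : index -> chart R m points ;
  points_hausdorff : hausdorff_space points ;
  points_second_countable : @second_countable points ;
  atlas_cover : forall p : points, exists c, cdom (atlas c) p ;
  atlas_smooth : forall c d,
    smooth_on (overlap (atlas c) (atlas d)) (transition (atlas c) (atlas d)) }.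
Arguments atlas {R m} _ _.

Lemma rV_second_countable (R : realType) (n : nat) :
  @second_countable 'rV[R]_n.
Proof.
pose U (qk : 'rV[rat]_n * nat) : set 'rV[R]_n :=
  (ball (map_mx (@ratr R) qk.1) (qk.2.+1%:R^-1 : R))°.
exists (range U); first by apply: (@sub_countable _ _ _ [set: _]) => //; exact: card_image_le.
split; first by move=> _ [qk _ <-]; exact: open_interior.
move=> x V /nbhs_ballP [e /= e0 eV].
have [k ke] : exists k : nat, (k.+1%:R^-1 : R) < e / 2.
  have [//|k] := @ltr_add_invr R 0%R (e / 2); first by rewrite divr_gt0.
  by rewrite add0r => ke; exists k.
have k0 : 0 < (k.+1%:R^-1 : R) / 2 by rewrite divr_gt0.
have approx i : exists q : rat, `|x 0 i - ratr q| < (k.+1%:R^-1 : R) / 2.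
  have /rat_in_itvoo[q] : x 0 i - (k.+1%:R^-1 : R) / 2 <
    x 0 i + (k.+1%:R^-1 : R) / 2.
    by rewrite ltrBlDr -addrA ltrDl addr_gt0.
  rewrite in_itv/= => /andP[q1 q2]; exists q.
  by rewrite ltr_distlC q1 q2.
have [q qP] := choice approx.
pose c := map_mx (@ratr R) (\row_i q i).
have bxc : ball c (k.+1%:R^-1 / 2 : R) x.
  split=> [|i j]; first by rewrite divr_gt0.
  rewrite ord1 /c !mxE /ball /= distrC; exact: qP.
exists (U (\row_i q i, k)).
  split; first by exists (\row_i q i, k).
  apply/nbhs_ballP; exists (k.+1%:R^-1 / 2) => //= y xy.
  by rewrite [X in ball _ X](splitr) //; apply: ball_triangle xy.
move=> y /interior_subset /= cy; apply: eV.
rewrite [e]splitr; apply: (@ball_triangle _ _ c).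
  apply: (le_ball (ltW ke)); apply: (@le_ball _ _ _ (k.+1%:R^-1 / 2)).
    by rewrite ler_pdivrMr // ler_peMr // ler1n.
  exact: ball_sym.
exact: (le_ball (ltW ke)).
Qed.

Section EuclideanSpace.
Context (R : realType) (n : nat).

Program Definition id_chart : chart R n 'rV[R]_n :=
  @Chart R n 'rV[R]_n setT id id openT _ (fun _ _ => erefl) _ _.
Next Obligation. by rewrite image_id; exact: openT. Qed.
Next Obligation. by move=> p _; exact: cvg_id. Qed.
Next Obligation. by move=> p _; exact: cvg_id. Qed.

Program Definition Rspace : manifold R n :=
  @Manifold R n 'rV[R]_n unit (fun=> id_chart) (@norm_hausdorff _ _)
    (rV_second_countable _ _) (fun _ => ex_intro _ tt I) _.
Next Obligation. by move=> c d; exact: smooth_on_id. Qed.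

End EuclideanSpace.

Section Local.
Context (R : realType).

(* Gam x i j = nabla_{d_i} d_j at x *)
Definition christoffel (m : nat) := 'rV[R]_m -> 'I_m -> 'I_m -> 'rV[R]_m.

Definition bil (m n : nat) (B : 'I_m -> 'I_m -> 'rV[R]_n) (u v : 'rV[R]_m) :
  'rV[R]_n := \sum_i \sum_j (u 0 i * v 0 j) *: B i j.

Definition ip (m : nat) (G : 'M[R]_m) (u v : 'rV[R]_m) : R :=
  (u *m G *m v^T) 0 0.

Section Domain.
Context (m : nat).
Local Notation vec := 'rV[R]_m.
Local Notation e_ i := (delta_mx 0 i : 'rV[R]_m).
Implicit Types (G : vec -> 'M[R]_m) (Gam : christoffel m) (X Y Z : vec -> vec).

Definition cov Gam X Y : vec -> vec :=
  fun x => 'D_(X x) Y x + bil (Gam x) (X x) (Y x).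

Definition lie X Y : vec -> vec := fun x => 'D_(X x) Y x - 'D_(Y x) X x.

Definition curvature Gam X Y Z : vec -> vec :=
  fun x => cov Gam X (cov Gam Y Z) x - cov Gam Y (cov Gam X Z) x
           - cov Gam (lie X Y) Z x.

(* the vector v with g(v, d_l) = a_l for all l *)
Definition sharp G (x : vec) (a : 'rV[R]_m) : vec := a *m invmx (G x).

(* Koszul formula on coordinate fields *)
Definition levi_civita G : christoffel m := fun x i j =>
  sharp G x (\row_l (2^-1 * ('D_(e_ i) (fun y => G y j l) x
    + 'D_(e_ j) (fun y => G y i l) x - 'D_(e_ l) (fun y => G y i j) x))).

(* d_i g(d_l, d_j) = g(nabla_{d_i} d_l, d_j) + g(d_l, bar-nabla_{d_i} d_j) *)
Definition conjugate G Gam : christoffel m := fun x i j =>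
  sharp G x (\row_l ('D_(e_ i) (fun y => G y l j) x
    - ip (G x) (Gam x i l) (e_ j))).

(* K(d_i, d_j) *)
Definition difference G Gam : christoffel m :=
  fun x i j => Gam x i j - levi_civita G x i j.

(* L(z, w)v, defined by g(L(z, w)v, y) = g(R(v, y)z, w); R being tensorial, it  *)
(* is computed on the fields with constant components v, y, z.                  *)
Definition interchange G Gam (x z w v : vec) : vec :=
  sharp G x (\row_l ip (G x)
    (curvature Gam (cst v) (cst (e_ l)) (cst z) x) w).

(* (nabla_u g)(v, w) *)
Definition nabla_metric G Gam (x u v w : vec) : R :=
  'D_u (fun y => ip (G y) v w) x - ip (G x) (bil (Gam x) u v) w
  - ip (G x) v (bil (Gam x) u w).

(* trace of v |-> nabla^g_v X *)
Definition divergence G X (x : vec) : R :=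
  \sum_k cov (levi_civita G) (cst (e_ k)) X x 0 k.

(* V is meant to be open *)
Definition orthonormal_frame G (V : set vec) (E : 'I_m -> vec -> vec) : Prop :=
  (forall i, smooth_on V (E i)) /\
  (forall x, V x -> forall i j, ip (G x) (E i x) (E j x) = (i == j)%:R).

Definition trace_K G Gam (E : 'I_m -> vec -> vec) : vec -> vec :=
  fun x => \sum_i bil (difference G Gam x) (E i x) (E i x).

(* sum_i (nabla_{e_i} S) e_i *)
Definition trace_nabla Gam (S : vec -> 'M[R]_m) (E : 'I_m -> vec -> vec) :
  vec -> vec :=
  fun x => \sum_i (cov Gam (E i) (fun y => E i y *m S y) x
                   - cov Gam (E i) (E i) x *m S x).

End Domain.

(* Maps U : R^m -> R^n; sections of the pull-back bundle are functions
   R^m -> R^n. *)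
Section Maps.
Context (m n : nat).
Local Notation vec := 'rV[R]_m.
Local Notation wec := 'rV[R]_n.
Implicit Types (GM : vec -> 'M[R]_m) (GN : wec -> 'M[R]_n).
Implicit Types (GamM : christoffel m) (GamN : christoffel n).
Implicit Types (U xi : vec -> wec) (E : 'I_m -> vec -> vec).

Definition push U (X : vec -> vec) : vec -> wec := fun x => 'D_(X x) U x.

Definition cov_along GamN U (X : vec -> vec) xi : vec -> wec :=
  fun x => 'D_(X x) xi x + bil (GamN (U x)) (push U X x) (xi x).

Definition tension GamM GamN U E : vec -> wec :=
  fun x => \sum_i (cov_along GamN U (E i) (push U (E i)) x
                   - push U (cov GamM (E i) (E i)) x).

Definition rough_laplacian GamM GamN U E xi : vec -> wec :=
  fun x => \sum_i (cov_along GamN U (E i) (cov_along GamN U (E i) xi) x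
                   - cov_along GamN U (cov GamM (E i) (E i)) xi x).

Definition bitension GM GamM GN GamN U E : vec -> wec := fun x =>
  let t := tension GamM GamN U E in
  rough_laplacian (conjugate GM GamM) (conjugate GN GamN) U E t x
  + divergence GM (trace_K GM GamM E) x *: t x
  - \sum_i interchange GN GamN (U x) (push U (E i) x) (t x) (push U (E i) x)
  - bil (difference GN GamN (U x)) (t x) (t x).

End Maps.

(* Riemannian volume form for the orientation in which the frames with om > 0
   are positively oriented *)
Definition volume_form (m : nat) (G : 'M[R]_m) (om : ('I_m -> 'rV[R]_m) -> R)
    (v : 'I_m -> 'rV[R]_m) : R :=
  Num.sg (om v) * Num.sqrt (\det (\matrix_(i, j) ip G (v i) (v j))).

End Local.

Section Fields.
Context (R : realType) (m : nat) (M : manifold R m).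

Definition img (c : index M) : set 'rV[R]_m := cimg (atlas M c).
Definition chg (c d : index M) := transition (atlas M c) (atlas M d).
Definition ovl (c d : index M) := overlap (atlas M c) (atlas M d).

Record metric := Metric {
  gmat :> index M -> 'rV[R]_m -> 'M[R]_m ;
  gmat_smooth : forall c, smooth_on (img c) (gmat c) ;
  gmat_sym : forall c x, img c x -> (gmat c x)^T = gmat c x ;
  gmat_pos : forall c x u, img c x -> u != 0 -> 0 < ip (gmat c x) u u ;
  gmat_change : forall c d x u v, ovl c d x ->
    ip (gmat d (chg c d x)) ('D_u (chg c d) x) ('D_v (chg c d) x)
    = ip (gmat c x) u v }.

Record connection := Connection {
  gam :> index M -> christoffel R m ;
  gam_smooth : forall c i j, smooth_on (img c) (fun x => gam c x i j) ;
  gam_change : forall c d x u v, ovl c d x ->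
    'D_u ('D_v (chg c d)) x
      + bil (gam d (chg c d x)) ('D_u (chg c d) x) ('D_v (chg c d) x)
    = 'D_(bil (gam c x) u v) (chg c d) x }.

Record endo_field := EndoField {
  emat :> index M -> 'rV[R]_m -> 'M[R]_m ;
  emat_smooth : forall c, smooth_on (img c) (emat c) ;
  emat_change : forall c d x v, ovl c d x ->
    'D_v (chg c d) x *m emat d (chg c d x) = 'D_(v *m emat c x) (chg c d) x }.

Record one_form := OneForm {
  omat :> index M -> 'rV[R]_m -> 'cV[R]_m ;
  omat_smooth : forall c, smooth_on (img c) (omat c) ;
  omat_change : forall c d x v, ovl c d x ->
    'D_v (chg c d) x *m omat d (chg c d x) = v *m omat c x }.

Definition torsion_free (nab : connection) : Prop :=
  forall c x u v, img c x -> bil (nab c x) u v = bil (nab c x) v u.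

Definition statistical (g : metric) (nab : connection) : Prop :=
  torsion_free nab /\
  forall c x u v w, img c x ->
    nabla_metric (g c) (nab c) x u v w = nabla_metric (g c) (nab c) x v u w.

Definition trace_free (S : endo_field) : Prop :=
  forall c x, img c x -> \tr (S c x) = 0.

Definition endo_zero (S : endo_field) : Prop :=
  forall c x, img c x -> S c x = 0.

Definition trace_nabla_zero (g : metric) (nab : connection) (S : endo_field) :
  Prop :=
  forall c V E, open V -> V `<=` img c -> orthonormal_frame (g c) V E ->
  forall x, V x -> trace_nabla (nab c) (S c) E x = 0.

End Fields.

Section Biharmonic.
Context (R : realType) (m n : nat) (M : manifold R m) (N : manifold R n).

Definition local_rep (u : M -> N) (c : index M) (d : index N) :
  'rV[R]_m -> 'rV[R]_n := coord (atlas N d) \o u \o param (atlas M c).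

Definition local_dom (u : M -> N) (c : index M) (d : index N) : set 'rV[R]_m :=
  [set x | img c x /\ cdom (atlas N d) (u (param (atlas M c) x))].

Definition smooth_map (u : M -> N) : Prop :=
  continuous u /\ forall c d, smooth_on (local_dom u c d) (local_rep u c d).

Definition immersion (u : M -> N) : Prop :=
  smooth_map u /\
  forall c d x v, local_dom u c d x -> 'D_v (local_rep u c d) x = 0 -> v = 0.

(* tau(u), like tau_2(u) below, does not depend on the charts and on the frame. *)
Definition tension_nonvanishing (g : metric M) (nab : connection M)
    (nabN : connection N) (u : M -> N) : Prop :=
  forall c d V E, open V -> V `<=` local_dom u c d ->
  orthonormal_frame (g c) V E ->
  forall x, V x -> tension (nab c) (nabN d) (local_rep u c d) E x != 0.

Definition bitension_zero (g : metric M) (nab : connection M)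
    (k : metric N) (nabN : connection N) (u : M -> N) : Prop :=
  forall c d V E, open V -> V `<=` local_dom u c d ->
  orthonormal_frame (g c) V E ->
  forall x, V x ->
    bitension (g c) (nab c) (k d) (nabN d) (local_rep u c d) E x = 0.

Definition statistical_biharmonic (g : metric M) (nab : connection M)
    (k : metric N) (nabN : connection N) (u : M -> N) : Prop :=
  [/\ statistical g nab, statistical k nabN, smooth_map u
    & bitension_zero g nab k nabN u].

End Biharmonic.

Section Flat.
Context (R : realType) (n : nat).

Program Definition flat_connection : connection (Rspace R n) :=
  @Connection R n (Rspace R n) (fun _ _ _ _ => 0) _ _.
Next Obligation. by move=> c i j; exact: smooth_on_cst. Qed.
Next Obligation.
move=> c d x u v _.
have bil0 (w z : 'rV[R]_n) : bil (fun _ _ : 'I_n => 0 : 'rV[R]_n) w z = 0.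
  by rewrite /bil big1 // => i _; rewrite big1 // => j _; rewrite scaler0.
rewrite !bil0 addr0 derive0 (_ : chg c d = id) //.
by rewrite derive_idE derive_cst.
Qed.

Definition std_det (v : 'I_n -> 'rV[R]_n) : R := \det (\matrix_(i < n) v i).

Definition compatible_metric (g0 : metric (Rspace R n)) : Prop :=
  (forall x i j, levi_civita (g0 tt) x i j = flat_connection tt x i j) /\
  (forall x v, volume_form (g0 tt x) std_det v = std_det v).

End Flat.

Section Hypersurface.
Context (R : realType) (m : nat) (M : manifold R m).
Implicit Types (f : M -> Rspace R (m + 1)) (xi : M -> 'rV[R]_(m + 1)).
Local Notation D := (flat_connection R (m + 1) tt).

Definition Frep f (c : index M) : 'rV[R]_m -> 'rV[R]_(m + 1) :=
  local_rep f c (tt : index (Rspace R (m + 1))).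

Definition sec_rep xi (c : index M) : 'rV[R]_m -> 'rV[R]_(m + 1) :=
  xi \o param (atlas M c).

Definition transversal f xi : Prop :=
  forall c x w, img c x -> 'D_w (Frep f c) x != sec_rep xi c x.

(* The affine fundamental form with respect to a suitable transversal vector nu
   is positive definite: a is its value on (u, u). *)
Definition locally_strongly_convex f : Prop :=
  immersion f /\
  forall c x, img c x -> exists nu : 'rV[R]_(m + 1),
    (forall w, 'D_w (Frep f c) x != nu) /\
    forall u, u != 0 -> exists w a, 0 < a /\
      cov_along D (Frep f c) (cst u) (push (Frep f c) (cst u)) x
      = 'D_w (Frep f c) x + a *: nu.

Definition gauss_formula f xi (nab : connection M) (h : metric M) : Prop :=
  forall c V X Y, open V -> V `<=` img c -> smooth_on V X -> smooth_on V Y ->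
  forall x, V x ->
    cov_along D (Frep f c) X (push (Frep f c) Y) x
    = push (Frep f c) (cov (nab c) X Y) x
      + ip (h c x) (X x) (Y x) *: sec_rep xi c x.

Definition weingarten_formula f xi (S : endo_field M) (theta : one_form M) :
  Prop :=
  forall c V X, open V -> V `<=` img c -> smooth_on V X ->
  forall x, V x ->
    cov_along D (Frep f c) X (sec_rep xi c) x
    = - push (Frep f c) (fun y => X y *m S c y) x
      + (X x *m theta c x) 0 0 *: sec_rep xi c x.

(* det(f_* v_1, ..., f_* v_m, xi) *)
Definition induced_volume f xi c x (v : 'I_m -> 'rV[R]_m) : R :=
  \det (col_mx (\matrix_(i < m) 'D_(v i) (Frep f c) x) (sec_rep xi c x)).

(* xi is the Blaschke normal vector field of f, with Blaschke metric h, affine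
   shape operator S and induced connection nab.  That h is a Riemannian metric
   is part of its type. *)
Definition blaschke_structure f xi (h : metric M) (nab : connection M)
    (S : endo_field M) : Prop :=
  [/\ forall c, smooth_on (img c) (sec_rep xi c),
      transversal f xi,
      gauss_formula f xi nab h,
      exists theta : one_form M, weingarten_formula f xi S theta /\
        forall c x, img c x -> theta c x = 0
    & forall c x v, img c x ->
        volume_form (h c x) (induced_volume f xi c x) v
        = induced_volume f xi c x v].

End Hypersurface.

(* Main.v *)
Require Import Defs.
From mathcomp Require Import all_boot all_order all_algebra.
From mathcomp Require Import all_classical all_reals all_analysis.
From mathcomp Require Import perm ring lra.

(** Let [E i] be an orthonormal frame of the Blaschke metric [h], and write [D]
    for the flat derivative.  By the Gauss formula the difference between
    [D_(E i) (f_* E i)] and [f_* (nabla_(E i) E i)] is [h (E i, E i) xi = xi],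
    so the tension field is [m xi] ([tension_blaschke]); it has no zero because
    [xi] is transversal.

    A Euclidean metric whose Levi-Civita connection is [D] is constant, hence
    [D] is its own conjugate, and the terms of the bitension field which involve
    [L] and [K] of the target vanish.  What remains is [m] times the rough
    Laplacian of [xi] plus [m div (tr_h K) xi].  The Weingarten formula followed
    by the Gauss formula gives
    [D_(E i) (D_(E i) xi) = - f_* (nabla_(E i) (S E i)) - h (E i, S E i) xi].

    The rough Laplacian also contains the conjugate connection of [nabla], and
    the divergence term contains [K].  Both are governed by the cubic form
    [C = nabla h].  Comparing the normal components of the third derivatives of
    [f] shows that [C] is totally symmetric ([codazzi]); then [K] is [- C / 2]
    and the conjugate connection is [nabla + C], an index of [C] being raised
    ([ip_difference], [ip_conjugate]).  The volume condition makes
    [det (f_* E 1, .., f_* E m, xi)] equal to [1] or [-1], so its derivative is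
    zero.  By the structure equations and Jacobi's formula this derivative is the
    determinant times the trace of the connection matrix of the frame
    ([apolarity]), and therefore [C] is trace free.  It follows that [tr_h K = 0]
    and that the conjugate connection may be replaced by [nabla] in the
    Laplacian, whence [bitension_blaschke]:
    [tau_2 (f) = - m (f_* (tr_h nabla S) + (tr S) xi)].
    Since [f] is an immersion and [xi] is transversal, this vanishes if and only
    if both components do.

    The symmetry of second derivatives, needed for the torsion and for the
    Codazzi equation, is proved in Young's form ([derive_schwarz_scalar]).  The
    bitension field is expressed in orthonormal frames, so deducing [tr S = 0] at
    every point takes a frame around every point ([orthonormal_frame_exists]). *)

Set Implicit Arguments.
Unset Strict Implicit.
Unset Printing Implicit Defensive.
Import Order.TTheory GRing.Theory Num.Theory.
Import numFieldNormedType.Exports.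

(* Otherwise unification compares derivatives by unfolding them to limits. *)
#[local] Opaque derive.

(** * Directional derivatives *)

Section Calculus.
Local Open Scope classical_set_scope.
Local Open Scope ring_scope.
Context {R : realType}.

Section Deriv.
Context {V : normedModType R}.

Lemma derive_on_open (W : normedModType R) (A : set V) (F G : V -> W) x v :
  open A -> A x -> (forall y, A y -> F y = G y) -> 'D_v F x = 'D_v G x.
Proof.
move=> oA Ax FG; apply: near_eq_derive.
by apply: filterS (open_nbhs_nbhs (conj oA Ax)) => y /FG.
Qed.

(** The remainder terms of [F] and [G] agree near [x], so the differential of [F]
    serves for [G]. *)
Lemma differentiable_on_open (W : normedModType R) (A : set V) (F G : V -> W) x :
  open A -> A x -> (forall y, A y -> F y = G y) -> differentiable F x ->
  differentiable G x.
Proof.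
move=> oA Ax FG dF.
have nFG : \forall h \near 0, F (h + x) = G (h + x).
  have : \forall y \near x, F y = G y.
    by apply: filterS (open_nbhs_nbhs (conj oA Ax)) => y /FG.
  by rewrite (near_shift 0) subr0.
have [cF /eqaddoP oF] := (diff_locallyP _ _).1 dF.
have oG : G \o shift x = cst (G x) + 'd F x +o_ 0 id.
  apply/eqaddoP => e e0; near=> h.
  suff -> : (G \o shift x - (cst (G x) + 'd F x)) h =
            (F \o shift x - (cst (F x) + 'd F x)) h by near: h; exact: oF.
  by rewrite /= !fctE /= -(FG x Ax); congr (_ - _); apply/esym; near: h.
by apply/diff_locallyP; rewrite (diff_unique cF oG).
Unshelve. all: by end_near. Qed.

Lemma differentiable_locally (W : normedModType R) (F : V -> W) x e :
  differentiable F x -> 0 < e ->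
  \forall h \near 0, `|F (h + x) - F x - 'd F x h| <= e * `|h|.
Proof.
move=> dF e0; have [_ /eqaddoP oF] := (diff_locallyP _ _).1 dF.
have := oF _ e0; apply: filterS => h.
by rewrite !fctE/= opprD addrA.
Qed.

Lemma is_derive_line (W : normedModType R) (F : V -> W) (u y : V) (s : R) :
  differentiable F (s *: u + y) ->
  is_derive s 1 (fun s => F (s *: u + y)) ('D_u F (s *: u + y)).
Proof.
move=> dF.
pose phi (s : R) := s *: u + y.
have dl : is_diff s phi (fun s : R => s *: u).
  have := @is_diffD _ _ _ _ _ _ _ _ (is_diff_scalel s u) (is_diff_cst y s).
  by rewrite addr0.
have dphi : differentiable phi s by exact: ex_diff.
have dc : differentiable (F \o phi) s by exact: differentiable_comp.
apply: DeriveDef; first exact: diff_derivable.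
rewrite deriveE//; rewrite [X in X 1](diff_comp dphi dF)/= deriveE//.
by rewrite [X in 'd _ _ (X 1)](diff_val (is_diff_def := dl)) scale1r.
Qed.

(** Mean value theorem for [s |-> f (s u + t v + x) - f (s u + x)] on the interval
    from [0] to [t]: the second difference is [t] times an increment of ['D_u f],
    and differentiability of ['D_u f] at the single point [x] evaluates this
    increment up to [o(t)]. *)
Lemma second_difference (f : V -> R) (A : set V) x u v (e : R) :
  open A -> A x -> (forall y, A y -> differentiable f y) ->
  differentiable ('D_u f) x -> 0 < e ->
  \forall t \near 0^'+, `|f (t *: u + (t *: v + x)) - f (t *: u + x)
      - (f (t *: v + x) - f x) - 'D_v ('D_u f) x * t ^+ 2| <= e * t ^+ 2.
Proof.
move=> oA Ax df dp e0; set p := 'D_u f in dp *.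
(* [t * c] bounds [s *: u + q *: v] for [s] and [q] between [0] and [t]; the
   summand [1] keeps [c] positive. *)
pose c := `|u| + `|v| + 1.
have c0 : 0 < c by rewrite ltr_wpDl// addr_ge0.
have e'0 : 0 < e / (2 * c) by rewrite divr_gt0// mulr_gt0.
have nA : \forall h \near 0, A (h + x).
  have : \forall y \near x, A y by exact: open_nbhs_nbhs (conj oA Ax).
  by rewrite (near_shift 0) subr0.
have : \forall h \near (0 : V),
    A (h + x) /\ `|p (h + x) - p x - 'd p x h| <= e / (2 * c) * `|h|.
  exact: filterI nA (differentiable_locally dp e'0).
move=> /nbhs_ballP[r /= r0 rP].
near=> t.
have t0 : 0 < t by near: t; exact: nbhs_right_gt.
have tr : t * c < r.
  by rewrite -ltr_pdivlMr//; near: t; apply: nbhs_right_lt; rewrite divr_gt0.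
have sP s q : 0 <= s <= t -> 0 <= q <= t -> `|s *: u + q *: v| <= t * c.
  move=> /andP[s0 st] /andP[q0 qt]; rewrite (le_trans (ler_normD _ _))//.
  rewrite !normrZ !ger0_norm// /c !mulrDr mulr1 -[leLHS]addr0 lerD// ?(ltW t0)//.
  by rewrite lerD// ler_wpM2r.
have bP s q : 0 <= s <= t -> 0 <= q <= t -> ball 0 r (s *: u + q *: v).
  move=> s0 q0; rewrite -ball_normE/= sub0r normrN.
  exact: le_lt_trans (sP _ _ s0 q0) tr.
have tt : 0 <= t <= t by rewrite lexx ltW.
have t00 : 0 <= (0:R) <= t by rewrite lexx ltW.
have dg s : 0 <= s <= t -> is_derive s 1
    (fun s => f (s *: u + (t *: v + x)) - f (s *: u + x))
    (p (s *: u + (t *: v + x)) - p (s *: u + x)).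
  move=> s0; apply: is_deriveB; apply: is_derive_line; apply: df.
    by rewrite addrA; have [] := rP _ (bP _ _ s0 tt).
  by have [] := rP _ (bP _ _ s0 t00); rewrite scale0r addr0.
have dg' s : s \in `]0, t[%R -> is_derive s 1
    (fun s => f (s *: u + (t *: v + x)) - f (s *: u + x))
    (p (s *: u + (t *: v + x)) - p (s *: u + x)).
  by rewrite in_itv/= => /andP[s0 st]; apply: dg; rewrite !ltW.
have [|s] := MVT t0 dg'.
  apply: derivable_within_continuous => s.
  by rewrite in_itv/= => /dg [].
rewrite in_itv/= => /andP[s0 st].
rewrite !scale0r !add0r => ->.
have s0t : 0 <= s <= t by rewrite !ltW.
have [_] := rP _ (bP _ _ s0t tt); have [_] := rP _ (bP _ _ s0t t00).
rewrite scale0r addr0 addrA => h1 h2.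
have su : `|s *: u| <= t * c by have := sP _ _ s0t t00; rewrite scale0r addr0.
have kc : e / (2 * c) * (t * c) = e / 2 * t by field; rewrite gt_eqF.
have {}h1 := le_trans h1 (ler_wpM2l (ltW e'0) su).
have {}h2 := le_trans h2 (ler_wpM2l (ltW e'0) (sP _ _ s0t tt)).
rewrite kc in h1 h2.
have dE : 'd p x (s *: u + t *: v) = 'd p x (s *: u) + t * 'D_v p x.
  by rewrite linearD deriveE// [X in _ + X]linearZ.
rewrite dE in h2.
set a := p (_ + _ + x) in h2 *; set b := p (_ + x) in h1 *.
rewrite subr0 [X in X <= _](_ : _ = `|a - b - t * 'D_v p x| * t); last first.
  have nE y : `|y| * t = `|y * t| by rewrite normrM (gtr0_norm t0).
  by rewrite nE; congr `|_|; ring.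
rewrite expr2 mulrA ler_wpM2r ?(ltW t0)//.
rewrite [X in `|X|](_ : _ = (a - p x - ('d p x (s *: u) + t * 'D_v p x))
   - (b - p x - 'd p x (s *: u))); last by ring.
by rewrite (le_trans (ler_normB _ _))// [e in leRHS]splitr mulrDl lerD.
Unshelve. all: by end_near. Qed.

(** Young's theorem: the second difference is symmetric in [u] and [v], and its
    quotient by [t ^+ 2] tends to both mixed derivatives. *)
Lemma derive_schwarz_scalar (f : V -> R) (A : set V) x u v :
  open A -> A x -> (forall y, A y -> differentiable f y) ->
  differentiable ('D_u f) x -> differentiable ('D_v f) x ->
  'D_v ('D_u f) x = 'D_u ('D_v f) x.
Proof.
move=> oA Ax df du dv.
have small (a b : R) : (forall e, 0 < e -> `|a - b| <= 2 * e) -> a = b.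
  move=> ab; apply/eqP; rewrite -subr_eq0 -normr_le0; apply/ler_addgt0Pr => e e0.
  by rewrite add0r (le_trans (ab (e / 2) _)) ?divr_gt0// mulrC divfK.
apply: small => e e0.
have [t [t0 [h1 h2]]] := filter_ex (filterI (nbhs_right_gt (0 : R))
  (filterI (second_difference v oA Ax df du e0)
           (second_difference u oA Ax df dv e0))).
have t20 : 0 < t ^+ 2 by rewrite exprn_gt0.
rewrite addrCA in h2.
set a := f (t *: u + (t *: v + x)) in h1 h2; set b := f (t *: u + x) in h1 h2.
set c := f (t *: v + x) in h1 h2.
rewrite [a - c - _](_ : _ = a - b - (c - f x)) in h2; last by ring.
have nE y : `|y| * t ^+ 2 = `|y * t ^+ 2| by rewrite normrM (gtr0_norm t20).
rewrite -(ler_pM2r t20) nE mulrBl.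
have -> : 2 * e * t ^+ 2 = e * t ^+ 2 + e * t ^+ 2 by ring.
apply: le_trans (ler_distD (a - b - (c - f x)) _ _) _; apply: lerD h2.
by rewrite distrC; exact: h1.
Qed.

Lemma deriveDl (W : normedModType R) (F : V -> W) x u v :
  differentiable F x -> 'D_(u + v) F x = 'D_u F x + 'D_v F x.
Proof. by move=> dF; rewrite !deriveE// linearD. Qed.

Lemma deriveZl (W : normedModType R) (F : V -> W) x a v :
  differentiable F x -> 'D_(a *: v) F x = a *: 'D_v F x.
Proof. by move=> dF; rewrite !deriveE// linearZ. Qed.

Lemma differentiable_mx p q (F : V -> 'M[R]_(p, q)) x :
  (forall i j, differentiable (fun y => F y i j) x) -> differentiable F x.
Proof.
move=> dF.
rewrite (_ : F = \sum_i \sum_j (fun y => F y i j *: delta_mx i j)).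
  apply: differentiable_sum => i; apply: differentiable_sum => j.
  exact: differentiableZl.
apply/funext => y; rewrite fct_sumE [LHS]matrix_sum_delta.
by apply: eq_bigr => i _; rewrite fct_sumE.
Qed.

Lemma differentiable_coordE p q (F : V -> 'M[R]_(p, q)) x i j :
  differentiable F x -> differentiable (fun y => F y i j) x.
Proof.
move=> dF; apply: (@differentiable_comp _ _ _ _ F (fun M : 'M[R]_(p, q) => M i j)) => //.
exact: differentiable_coord.
Qed.

Lemma derive_coord p q (F : V -> 'M[R]_(p, q)) x v i j :
  derivable F x v -> 'D_v (fun y => F y i j) x = ('D_v F x) i j.
Proof. by move=> dF; rewrite derive_mx// mxE. Qed.

Lemma diff_coord p q (F : V -> 'M[R]_(p, q)) x v i j :
  differentiable F x -> ('D_v F x) i j = 'D_v (fun y => F y i j) x.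
Proof. by move=> dF; apply/esym/derive_coord; exact: diff_derivable. Qed.

Lemma derive_mulmx p q r (F : V -> 'M[R]_(p, q)) (G : V -> 'M[R]_(q, r)) x v :
  derivable F x v -> derivable G x v ->
  is_derive x v (fun y => F y *m G y) ('D_v F x *m G x + F x *m 'D_v G x).
Proof.
move=> dF dG.
have dFc i j := (derivable_mxP F x v).1 dF i j.
have dGc i j := (derivable_mxP G x v).1 dG i j.
have dc i j : is_derive x v (fun y => (F y *m G y) i j)
    (('D_v F x *m G x + F x *m 'D_v G x) i j).
  rewrite (_ : (fun y => _) = \sum_k (fun y => F y i k * G y k j)); last first.
    by apply/funext => y; rewrite fct_sumE mxE.
  rewrite !mxE -big_split/=; apply: is_derive_sum => k.
  rewrite -(derive_coord _ _ dF) -(derive_coord _ _ dG).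
  apply: is_derive_eq; first by apply: is_deriveM; exact: derivableP.
  by rewrite /= addrC; congr (_ + _); rewrite mulrC.
have dFG : derivable (fun y => F y *m G y) x v.
  by apply/derivable_mxP => i j; have [] := dc i j.
apply: DeriveDef => //; apply/matrixP => i j.
by rewrite -derive_coord// derive_val.
Qed.

Lemma derive_trmx p q (F : V -> 'M[R]_(p, q)) x v :
  derivable F x v -> is_derive x v (fun y => (F y)^T) ('D_v F x)^T.
Proof.
move=> dF; have dFc i j := (derivable_mxP F x v).1 dF i j.
have dT : derivable (fun y => (F y)^T) x v.
  apply/derivable_mxP => i j; rewrite (_ : (fun y => _) = (fun y => F y j i)) //.
  by apply/funext => y; rewrite mxE.
apply: DeriveDef => //; apply/matrixP => i j.
rewrite -derive_coord// mxE -derive_coord//; congr ('D_v _ x).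
by apply/funext => y; rewrite mxE.
Qed.

Lemma is_derive_ip p (G : V -> 'M[R]_p) (X Y : V -> 'rV[R]_p) x v :
  derivable G x v -> derivable X x v -> derivable Y x v ->
  is_derive x v (fun y => ip (G y) (X y) (Y y))
    (ip ('D_v G x) (X x) (Y x) + ip (G x) ('D_v X x) (Y x)
     + ip (G x) (X x) ('D_v Y x)).
Proof.
move=> dG dX dY.
have h1 := derive_mulmx dX dG; have h2 := derive_trmx dY.
have h3 := derive_mulmx (@ex_derive _ _ _ _ _ _ _ h1) (@ex_derive _ _ _ _ _ _ _ h2).
apply: DeriveDef.
  exact: (derivable_mxP _ x v).1 (@ex_derive _ _ _ _ _ _ _ h3) 0 0.
rewrite derive_coord; last exact: (@ex_derive _ _ _ _ _ _ _ h3).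
rewrite (derive_val (is_derive := h3)) (derive_val (is_derive := h1)).
rewrite (derive_val (is_derive := h2)) /ip mulmxDl !mxE.
by ring.
Qed.

Lemma derive_schwarz p q (F : V -> 'M[R]_(p, q)) (A : set V) x u v :
  open A -> A x -> (forall y, A y -> differentiable F y) ->
  differentiable ('D_u F) x -> differentiable ('D_v F) x ->
  'D_v ('D_u F) x = 'D_u ('D_v F) x.
Proof.
move=> oA Ax dF du dv; apply/matrixP => i j.
have DE w y : A y -> 'D_w F y i j = 'D_w (fun z => F z i j) y.
  by move=> Ay; exact: diff_coord (dF y Ay).
refine (etrans (diff_coord v i j du) (etrans _ (esym (diff_coord u i j dv)))).
rewrite (derive_on_open v oA Ax (DE u)) (derive_on_open u oA Ax (DE v)).
apply: (derive_schwarz_scalar oA Ax).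
- by move=> y Ay; apply: differentiable_coordE; exact: dF.
- by apply: (differentiable_on_open oA Ax (DE u)); exact: differentiable_coordE.
- by apply: (differentiable_on_open oA Ax (DE v)); exact: differentiable_coordE.
Qed.

(** Writing the [i]-th term as a full product with one factor replaced, instead of
    a product over [j != i], turns a sum over permutations of such terms into a
    determinant. *)
Lemma is_derive_prod n (F : 'I_n -> V -> R) (dF : 'I_n -> R) x v :
  (forall i, is_derive x v (F i) (dF i)) ->
  is_derive x v (fun y => \prod_i F i y)
    (\sum_i \prod_j (if j == i then dF j else F j x)).
Proof.
elim: n F dF => [|n IH] F dF dFP.
  rewrite big_ord0 (_ : (fun y => _) = cst 1); first exact: is_derive_cst.
  by apply/funext => y; rewrite big_ord0.
have h := is_deriveM (dFP ord0) (IH _ _ (fun i => dFP (lift ord0 i))).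
rewrite (_ : (fun y => _) = F ord0 * (fun y => \prod_i F (lift ord0 i) y)).
  apply: is_derive_eq h _.
  rewrite big_ord_recl big_ord_recl eqxx addrC /=; congr (_ + _).
    by rewrite [LHS]mulrC; congr (_ * _); apply: eq_bigr.
  rewrite scaler_sumr; apply: eq_bigr => i _.
  by rewrite [RHS]big_ord_recl (negPf (neq_lift ord0 i)); congr (_ * _).
by apply/funext => y; rewrite big_ord_recl.
Qed.

Lemma is_derive_bigsum (W : normedModType R) (I : Type) (r : seq I)
    (F : I -> V -> W) (dF : I -> W) x v :
  (forall i, is_derive x v (F i) (dF i)) ->
  is_derive x v (fun y => \sum_(i <- r) F i y) (\sum_(i <- r) dF i).
Proof.
move=> dFP; elim: r => [|i r IH].
  rewrite big_nil (_ : (fun y => _) = cst 0); first exact: is_derive_cst.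
  by apply/funext => y; rewrite big_nil.
rewrite big_cons (_ : (fun y => _) = F i + (fun y => \sum_(i <- r) F i y)).
  exact: is_deriveD.
by apply/funext => y; rewrite big_cons.
Qed.

(** Jacobi's formula: the Leibniz expansion gives the sum over [i] of the
    determinants with row [i] differentiated, and expanding each along that row
    produces the entries of the adjugate. *)
Lemma is_derive_det n (B : V -> 'M[R]_n) x v :
  derivable B x v ->
  is_derive x v (fun y => \det (B y)) (\tr ('D_v B x *m \adj (B x))).
Proof.
move=> dB; have dBc i j := (derivable_mxP B x v).1 dB i j.
have dPP (s : 'S_n) : is_derive x v (fun y => (-1) ^+ s * \prod_i B y i (s i))
    ((-1) ^+ s *
     \sum_i \prod_j (if j == i then ('D_v B x) j (s j) else B x j (s j))).
  apply: is_deriveZ; apply: is_derive_prod => i.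
  by rewrite -derive_coord//; exact: derivableP.
apply: is_derive_eq; first exact: (is_derive_bigsum _ dPP).
under eq_bigr do rewrite mulr_sumr.
rewrite exchange_big; apply: eq_bigr => i _.
pose C := \matrix_(j, k) (if j == i then 'D_v B x j k else B x j k).
transitivity (\det C).
  by apply: eq_bigr => s _; congr (_ * _); apply: eq_bigr => j _; rewrite mxE.
rewrite (expand_det_row _ i) mxE; apply: eq_bigr => k _.
rewrite !mxE eqxx; congr (_ * (_ * \det _)).
by apply/matrixP => a b; rewrite !mxE eq_sym (negPf (neq_lift _ _)).
Qed.

End Deriv.

Lemma continuous_mx (T : topologicalType) p q (F : T -> 'M[R]_(p, q)) x :
  (forall i j, {for x, continuous (fun y => F y i j)}) -> {for x, continuous F}.
Proof.
move=> cF; apply/(@cvg_ballP _ _ _ (nbhs x) _ F (F x)) => e e0.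
have h : \forall y \near x, forall i j, ball (F x i j) e (F y i j).
  apply: filter_forall => i; apply: filter_forall => j.
  by have /(@cvg_ballP _ _ _ (nbhs x) _ _ (F x i j)) := cF i j; exact.
by apply: filterS h => y hy; split.
Qed.

Lemma continuous_on_open (T U : topologicalType) (A : set T) (F G : T -> U) x :
  open A -> A x -> (forall y, A y -> F y = G y) ->
  {for x, continuous F} -> {for x, continuous G}.
Proof.
move=> oA Ax FG cF; have nA : \forall y \near x, A y := open_nbhs_nbhs (conj oA Ax).
suff : G y @[y --> x] --> F x by rewrite (FG x Ax).
apply: cvg_trans cF; apply: near_eq_cvg.
by apply: filterS nA => y /FG /esym.
Qed.

Lemma derive_sqrt (V : normedModType R) (F : V -> R) x v :
  0 < F x -> differentiable F x ->
  differentiable (fun y => Num.sqrt (F y)) x /\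
  'D_v (fun y => Num.sqrt (F y)) x = 'D_v F x * (2 * Num.sqrt (F x))^-1.
Proof.
move=> F0 dF; have [ds es] := is_derive1_sqrt F0.
have dS : differentiable (@Num.sqrt R) (F x) by apply/derivable1_diffP.
have dc : differentiable (@Num.sqrt R \o F) x by exact: differentiable_comp.
split=> //; have := congr1 (fun h : V -> R => h v) (diff_comp dF dS).
rewrite /= (deriv1E ds) derive1E es => e.
have e1 := deriveE v dc; have e2 := deriveE v dF.
exact: etrans e1 (etrans e (congr1 (fun z => z * _) (esym e2))).
Qed.

Lemma is_derive_mx (V : normedModType R) p q (F : V -> 'M[R]_(p, q))
    (dF : 'M[R]_(p, q)) x v :
  (forall i j, is_derive x v (fun y => F y i j) (dF i j)) -> is_derive x v F dF.
Proof.
move=> h; have dFx : derivable F x v by apply/derivable_mxP => i j; have [] := h i j.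
apply: DeriveDef => //; apply/matrixP => i j.
by have [_ <-] := h i j; apply/esym; exact: derive_coord.
Qed.

Lemma is_derive_scale (V : normedModType R) p q (a : V -> R)
    (F : V -> 'M[R]_(p, q)) x v :
  derivable a x v -> derivable F x v ->
  is_derive x v (fun y => a y *: F y) (a x *: 'D_v F x + 'D_v a x *: F x).
Proof.
move=> da dF; apply: is_derive_mx => i j.
have dFij : derivable (fun y => F y i j) x v by apply/(derivable_mxP F x v).1.
have h := is_deriveM (derivableP da) (derivableP dFij).
rewrite (_ : (fun y => _) = a * (fun y => F y i j)); last first.
  by apply/funext => y; rewrite mxE.
apply: is_derive_eq h _; rewrite !mxE; congr (_ + _); last by rewrite [LHS]mulrC.
by congr (_ * _); exact: derive_coord.
Qed.

(** * Functions of class C^k *)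

Section SmoothFunctions.
Context {m : nat}.
Local Notation V := 'rV[R]_m.
Implicit Types (A B : set V) (k : nat).

Lemma class_C_sub (W : normedModType R) k A B (F : V -> W) :
  B `<=` A -> class_C k A F -> class_C k B F.
Proof.
move=> BA; elim: k F => [|k IH] F /=; first by move=> cF x /BA; exact: cF.
by move=> [dF cF]; split=> [x /BA|v]; [exact: dF|exact: IH].
Qed.

Lemma class_C_eq (W : normedModType R) k A (F G : V -> W) :
  open A -> (forall x, A x -> F x = G x) -> class_C k A F -> class_C k A G.
Proof.
move=> oA; elim: k F G => [|k IH] F G FG /=.
  by move=> cF x Ax; exact: continuous_on_open oA Ax FG (cF x Ax).
move=> [dF cF]; split=> [x Ax|v].
  exact: differentiable_on_open oA Ax FG (dF x Ax).
by apply: IH (cF v) => x Ax; exact: derive_on_open oA Ax FG.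
Qed.

Lemma class_CW (W : normedModType R) k A (F : V -> W) :
  class_C k.+1 A F -> class_C k A F.
Proof.
elim: k F => [|k IH] F.
  by move=> [dF _] x Ax; apply: differentiable_continuous; exact: dF.
by move=> [dF cF]; split=> // v; apply: IH; exact: cF.
Qed.

(** Reduces smooth matrices to real-valued functions, for which products, inverses
    and square roots are treated below. *)
Lemma class_C_mx k p q A (F : V -> 'M[R]_(p, q)) :
  open A -> class_C k A F <-> forall i j, class_C k A (fun x => F x i j).
Proof.
move=> oA; elim: k F => [|k IH] F; split.
- move=> cF i j x Ax; apply: (@continuous_comp _ _ _ F (fun M : 'M[R]_(p, q) => M i j)).
    exact: cF.
  exact: coord_continuous.
- move=> cF x Ax.
  by apply: continuous_mx => i j; exact: cF.
- move=> [dF cF] i j; split=> [x Ax|v].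
    by apply: differentiable_coordE; exact: dF.
  apply: (class_C_eq oA _ ((IH _).1 (cF v) i j)) => x Ax.
  exact: diff_coord (dF x Ax).
- move=> cF; have dF x : A x -> differentiable F x.
    by move=> Ax; apply: differentiable_mx => i j; have [dFij _] := cF i j; exact: dFij.
  split=> // v; apply/IH => i j; have [_ cFij] := cF i j.
  apply: (class_C_eq oA _ (cFij v)) => x Ax.
  exact: esym (diff_coord v i j (dF x Ax)).
Qed.

Lemma class_CD (W : normedModType R) k A (F G : V -> W) :
  open A -> class_C k A F -> class_C k A G -> class_C k A (fun x => F x + G x).
Proof.
move=> oA; elim: k F G => [|k IH] F G.
  by move=> cF cG x Ax; apply: continuousD; [exact: cF|exact: cG].
move=> [dF cF] [dG cG]; split=> [x Ax|v].
  by apply: differentiableD; [exact: dF|exact: dG].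
apply: (class_C_eq oA _ (IH _ _ (cF v) (cG v))) => x Ax.
by rewrite deriveD//; apply: diff_derivable; [exact: dF|exact: dG].
Qed.

Lemma class_CM k A (F G : V -> R) :
  open A -> class_C k A F -> class_C k A G -> class_C k A (fun x => F x * G x).
Proof.
move=> oA; elim: k F G => [|k IH] F G.
  by move=> cF cG x Ax; apply: continuousM; [exact: cF|exact: cG].
move=> cF cG; have [dF cdF] := cF; have [dG cdG] := cG; split=> [x Ax|v].
  by apply: differentiableM; [exact: dF|exact: dG].
apply: (class_C_eq oA _ (class_CD oA (IH _ _ (class_CW cF) (cdG v))
                                     (IH _ _ (class_CW cG) (cdF v)))) => x Ax.
by rewrite deriveM//; apply: diff_derivable; [exact: dF|exact: dG].
Qed.

Lemma class_CV k A (F : V -> R) :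
  open A -> (forall x, A x -> F x != 0) -> class_C k A F ->
  class_C k A (fun x => (F x)^-1).
Proof.
move=> oA F0; elim: k => [|k IH].
  by move=> cF x Ax; apply: continuousV; [exact: F0|exact: cF].
move=> cF; have [dF cdF] := cF; split=> [x Ax|v].
  by apply: differentiableV; [exact: dF|exact: F0].
have cV := IH (class_CW cF).
apply: (class_C_eq oA _ (class_CM oA (class_C_cst k A (-1 : R))
  (class_CM oA (class_CM oA cV cV) (cdF v)))) => x Ax.
rewrite deriveV//; [|exact: F0|by apply: diff_derivable; exact: dF].
by rewrite -exprVn expr2 /cst mulN1r scaleNr.
Qed.

(** The derivative ['D_v F / (2 sqrt F)] involves [sqrt F] itself, so regularity is
    gained one order at a time. *)
Lemma class_C_sqrt k A (F : V -> R) :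
  open A -> (forall x, A x -> 0 < F x) -> class_C k A F ->
  class_C k A (fun x => Num.sqrt (F x)).
Proof.
move=> oA F0; elim: k => [|k IH] cF.
  move=> x Ax; apply: (@continuous_comp _ _ _ F (@Num.sqrt R)); first exact: cF.
  exact: sqrt_continuous.
have [dF cdF] := cF.
split=> [x Ax|v]; first by have [] := derive_sqrt 0 (F0 _ Ax) (dF x Ax).
have cs := IH (class_CW cF).
have s0 x : A x -> 2 * Num.sqrt (F x) != 0.
  by move=> Ax; rewrite mulf_neq0// gt_eqF// sqrtr_gt0 F0.
apply: (class_C_eq oA _ (class_CM oA (cdF v)
  (class_CV oA s0 (class_CM oA (class_C_cst k A (2 : R)) cs)))) => x Ax.
by have [_ ->] := derive_sqrt v (F0 _ Ax) (dF x Ax).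
Qed.

Lemma class_C_sum (W : normedModType R) (I : Type) (r : seq I) k A
    (F : I -> V -> W) :
  open A -> (forall i, class_C k A (F i)) ->
  class_C k A (fun x => \sum_(i <- r) F i x).
Proof.
move=> oA cF; elim: r => [|i r IH].
  by apply: (class_C_eq oA _ (class_C_cst k A 0)) => x _; rewrite big_nil.
apply: (class_C_eq oA _ (class_CD oA (cF i) IH)) => x _.
by rewrite big_cons.
Qed.

Lemma class_C_mulmx k p q r A (F : V -> 'M[R]_(p, q)) (G : V -> 'M[R]_(q, r)) :
  open A -> class_C k A F -> class_C k A G -> class_C k A (fun x => F x *m G x).
Proof.
move=> oA /(class_C_mx _ _ oA) cF /(class_C_mx _ _ oA) cG; apply/class_C_mx => // i j.
apply: (class_C_eq oA (F := fun x => \sum_l F x i l * G x l j)) => [x _|].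
  by rewrite mxE.
by apply: class_C_sum => // l; exact: class_CM.
Qed.

Lemma class_C_trmx k p q A (F : V -> 'M[R]_(p, q)) :
  open A -> class_C k A F -> class_C k A (fun x => (F x)^T).
Proof.
move=> oA /(class_C_mx _ _ oA) cF; apply/class_C_mx => // i j.
by apply: (class_C_eq oA _ (cF j i)) => x _; rewrite mxE.
Qed.

Lemma class_C_scale k p q A (a : V -> R) (F : V -> 'M[R]_(p, q)) :
  open A -> class_C k A a -> class_C k A F -> class_C k A (fun x => a x *: F x).
Proof.
move=> oA ca /(class_C_mx _ _ oA) cF; apply/class_C_mx => // i j.
by apply: (class_C_eq oA _ (class_CM oA ca (cF i j))) => x _; rewrite mxE.
Qed.

Lemma class_C_ip k A (G : V -> 'M[R]_m) (X Y : V -> V) :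
  open A -> class_C k A G -> class_C k A X -> class_C k A Y ->
  class_C k A (fun x => ip (G x) (X x) (Y x)).
Proof.
move=> oA cG cX cY; apply: ((class_C_mx _ _ oA).1 _ 0 0).
by apply: class_C_mulmx => //; [exact: class_C_mulmx|exact: class_C_trmx].
Qed.

Lemma smooth_differentiable (W : normedModType R) A (F : V -> W) x :
  smooth_on A F -> A x -> differentiable F x.
Proof. by move=> /(_ 1%N) [dF _]; exact: dF. Qed.

Lemma smooth_derive (W : normedModType R) A (F : V -> W) v :
  smooth_on A F -> smooth_on A ('D_v F).
Proof. by move=> sF k; have [_ cF] := sF k.+1; exact: cF. Qed.

Lemma smooth_derivable (W : normedModType R) A (F : V -> W) x v :
  smooth_on A F -> A x -> derivable F x v.
Proof. by move=> sF Ax; apply: diff_derivable; exact: smooth_differentiable Ax. Qed.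

Lemma smooth_schwarz p q (F : V -> 'M[R]_(p, q)) A x u v :
  open A -> smooth_on A F -> A x -> 'D_v ('D_u F) x = 'D_u ('D_v F) x.
Proof.
move=> oA sF Ax; apply: (derive_schwarz oA Ax) => [y Ay||].
- exact: smooth_differentiable Ay.
- exact: smooth_differentiable (smooth_derive u sF) Ax.
- exact: smooth_differentiable (smooth_derive v sF) Ax.
Qed.

End SmoothFunctions.
End Calculus.

(** * Connection coefficients and push-forward *)

Section Coefficients.
Local Open Scope classical_set_scope.
Local Open Scope ring_scope.
Context {R : realType}.

Section Bil.
Context {m n : nat}.
Local Notation V := 'rV[R]_m.
Local Notation e_ i := (delta_mx 0 i : 'rV[R]_m).
Implicit Types (B : 'I_m -> 'I_m -> 'rV[R]_n) (u v w : V).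

Lemma bilDl B u v w : bil B (u + v) w = bil B u w + bil B v w.
Proof.
rewrite /bil -big_split; apply: eq_bigr => i _ /=.
rewrite -big_split; apply: eq_bigr => j _ /=.
by rewrite mxE mulrDl scalerDl.
Qed.

Lemma bilZl B a u w : bil B (a *: u) w = a *: bil B u w.
Proof.
rewrite /bil scaler_sumr; apply: eq_bigr => i _ /=.
rewrite scaler_sumr; apply: eq_bigr => j _ /=.
by rewrite mxE scalerA mulrA.
Qed.

Lemma bil_delta B i j : bil B (e_ i) (e_ j) = B i j.
Proof.
rewrite /bil (bigD1 i)//= [X in _ + X]big1 => [|k ki]; last first.
  by apply: big1 => l _; rewrite mxE eqxx (negPf ki) mul0r scale0r.
rewrite (bigD1 j)//= big1 => [|k kj]; last first.
  by rewrite [X in _ * X]mxE (negPf kj) andbF mulr0 scale0r.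
by rewrite !mxE !eqxx mulr1 scale1r !addr0.
Qed.

Lemma bil0 u v : bil (fun _ _ : 'I_m => 0 : 'rV[R]_n) u v = 0.
Proof. by apply: big1 => i _; apply: big1 => j _; rewrite scaler0. Qed.

Lemma bil0r B u : bil B u 0 = 0.
Proof.
by apply: big1 => i _; apply: big1 => j _; rewrite [X in _ * X]mxE mulr0 scale0r.
Qed.

Lemma bilB B B' u v : bil (fun i j => B i j - B' i j) u v = bil B u v - bil B' u v.
Proof.
rewrite /bil -sumrB; apply: eq_bigr => i _; rewrite -sumrB.
by apply: eq_bigr => j _; rewrite scalerBr.
Qed.
End Bil.

Lemma smooth_bil (m n : nat) (A : set 'rV[R]_m) (Gam : christoffel R m) u v :
  open A -> (forall i j, smooth_on A (fun x => Gam x i j)) ->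
  smooth_on A (fun x => bil (Gam x) u v).
Proof.
move=> oA sGam k; apply: class_C_sum => // i; apply: class_C_sum => // j.
by apply: class_C_scale => //; [exact: class_C_cst|exact: sGam].
Qed.

Lemma smooth_push (m n : nat) (A B : set 'rV[R]_m) (F : 'rV[R]_m -> 'rV[R]_n)
    (Y : 'rV[R]_m -> 'rV[R]_m) :
  open B -> B `<=` A -> smooth_on A F -> smooth_on B Y -> smooth_on B (push F Y).
Proof.
move=> oB BA sF sY k.
apply: (class_C_eq oB (F := fun y => \sum_i Y y 0 i *: 'D_(delta_mx 0 i) F y)).
  move=> y /BA Ay; have dF := smooth_differentiable sF Ay.
  rewrite /push [in RHS](row_sum_delta (Y y)).
  rewrite [RHS](deriveE _ dF) linear_sum; apply: eq_bigr => i _.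
  by rewrite linearZ /= -(deriveE _ dF).
apply: class_C_sum => // i; apply: class_C_scale => //.
  by apply: ((class_C_mx k Y oB).1 _ 0 i); exact: sY.
by apply: class_C_sub BA _; exact: smooth_derive.
Qed.

End Coefficients.

(** * Orthonormal frames *)

Section Frames.
Local Open Scope classical_set_scope.
Local Open Scope ring_scope.
Context {R : realType} {m : nat}.
Local Notation V := 'rV[R]_m.
Local Notation e_ i := (delta_mx 0 i : 'rV[R]_m).
Implicit Types (G S : 'M[R]_m) (u v w : V).

Lemma ipDl G u v w : ip G (u + v) w = ip G u w + ip G v w.
Proof. by rewrite /ip !mulmxDl mxE. Qed.

Lemma ipDr G u v w : ip G w (u + v) = ip G w u + ip G w v.
Proof. by rewrite /ip linearD mulmxDr mxE. Qed.

Lemma ipZl G a u w : ip G (a *: u) w = a * ip G u w.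
Proof. by rewrite /ip -!scalemxAl mxE. Qed.

Lemma ipZr G a u w : ip G w (a *: u) = a * ip G w u.
Proof. by rewrite /ip linearZ -scalemxAr mxE. Qed.

Lemma ipNl G u w : ip G (- u) w = - ip G u w.
Proof. by rewrite -scaleN1r ipZl mulN1r. Qed.

Lemma ip0l G w : ip G 0 w = 0.
Proof. by rewrite /ip !mul0mx mxE. Qed.

Lemma ip0r G w : ip G w 0 = 0.
Proof. by rewrite /ip linear0 mulmx0 mxE. Qed.

Lemma ip_suml (I : Type) (r : seq I) (P : pred I) G (u : I -> V) w :
  ip G (\sum_(i <- r | P i) u i) w = \sum_(i <- r | P i) ip G (u i) w.
Proof. by rewrite /ip !mulmx_suml summxE. Qed.

Lemma ip_sumr (I : Type) (r : seq I) (P : pred I) G (u : I -> V) w :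
  ip G w (\sum_(i <- r | P i) u i) = \sum_(i <- r | P i) ip G w (u i).
Proof. by rewrite /ip linear_sum mulmx_sumr summxE. Qed.

Lemma ipC G u v : G^T = G -> ip G u v = ip G v u.
Proof.
move=> sG; rewrite /ip.
have -> : v *m G *m u^T = (u *m G *m v^T)^T by rewrite !trmx_mul trmxK sG mulmxA.
by rewrite [RHS]mxE.
Qed.

Lemma ip_delta G i j : ip G (e_ i) (e_ j) = G i j.
Proof. by rewrite /ip trmx_delta -rowE -colE !mxE. Qed.

Lemma ip_row p q (P : 'M[R]_(p, m)) (Q : 'M[R]_(q, m)) G i j :
  ip G (row i P) (row j Q) = (P *m G *m Q^T) i j.
Proof.
rewrite /ip -row_mul tr_row [LHS]mxE [RHS]mxE; apply: eq_bigr => k _.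
by rewrite [row _ _ _ _]mxE [col _ _ _ _]mxE.
Qed.

Lemma nondegenerate_unitmx G : (forall u, u != 0 -> 0 < ip G u u) -> G \in unitmx.
Proof.
move=> pG; rewrite unitmxE unitfE; apply/negP => /det0P[u u0 uG].
by have := pG u u0; rewrite /ip uG mul0mx mxE ltxx.
Qed.

(** Gram-Schmidt applied to the coordinate frame.  The vectors produced after [k]
    steps involve the first [k] coordinates only, so that the next one, before
    normalisation, has coordinate [1] in the next direction and is nonzero. *)
Lemma orthonormal_frame_exists (A : set V) (G : V -> 'M[R]_m) :
  open A -> smooth_on A G -> (forall x, A x -> (G x)^T = G x) ->
  (forall x u, A x -> u != 0 -> 0 < ip (G x) u u) ->
  exists E : 'I_m -> V -> V, orthonormal_frame G A E.
Proof.
move=> oA sG symG posG.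
suff /(_ m (leqnn m)) [E [sE oE _]] : forall k, (k <= m)%N ->
    exists E : nat -> V -> V,
    [/\ forall i, (i < k)%N -> smooth_on A (E i),
        forall x i j, A x -> (i < k)%N -> (j < k)%N ->
          ip (G x) (E i x) (E j x) = (i == j)%:R
      & forall x i (l : 'I_m), A x -> (i < k)%N -> (k <= l)%N -> E i x 0 l = 0].
  by exists (fun i => E i); split=> [i|x Ax i j]; [exact: sE|exact: oE].
elim=> [|k IH] km; first by exists (fun=> cst 0).
have [E [sE oE tE]] := IH (ltnW km).
pose o := Ordinal km.
pose w x := e_ o - \sum_(i < k) ip (G x) (e_ o) (E i x) *: E i x.
have w0 x : A x -> w x != 0.
  move=> Ax; apply/negP => /eqP/matrixP/(_ 0 o).
  rewrite !mxE !eqxx summxE big1 ?subr0 => [/eqP|i _]; first by rewrite oner_eq0.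
  by rewrite mxE tE// mulr0.
have ww0 x : A x -> 0 < ip (G x) (w x) (w x) by move=> Ax; apply: posG => //; exact: w0.
have wE x i : A x -> (i < k)%N -> ip (G x) (w x) (E i x) = 0.
  move=> Ax ik; rewrite /w ipDl ipNl ip_suml (bigD1 (Ordinal ik))//= big1 => [|j ji].
    by rewrite ipZl oE// eqxx mulr1 addr0 subrr.
  rewrite ipZl oE//.
  by have /negPf -> : (j : nat) != i by []; rewrite mulr0.
pose n x := (Num.sqrt (ip (G x) (w x) (w x)))^-1.
have n2 x : A x -> n x * (n x * ip (G x) (w x) (w x)) = 1.
  move=> Ax; rewrite mulrA -expr2 exprVn sqr_sqrtr ?(ltW (ww0 x Ax))//.
  by rewrite mulVf// gt_eqF// ww0.
have sw : smooth_on A w.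
  move=> j; apply: class_CD => //; first exact: class_C_cst.
  apply: (class_C_eq oA (F := fun x =>
    (-1 : R) *: \sum_(i < k) ip (G x) (e_ o) (E i x) *: E i x)).
    by move=> x _; rewrite scaleN1r.
  apply: class_C_scale => //; first exact: class_C_cst.
  apply: class_C_sum => // i; apply: class_C_scale => //; last exact: sE.
  by apply: class_C_ip => //; [exact: class_C_cst|exact: sE].
have lt1 i : (i < k.+1)%N = (i == k) || (i < k)%N by rewrite ltnS leq_eqVlt.
exists (fun i => if i == k then fun x => n x *: w x else E i); split.
- move=> i; rewrite lt1; case: eqP => [-> _|_ /= ik]; last exact: sE.
  move=> j; apply: class_C_scale => //; apply: class_CV => //.
    by move=> x Ax; rewrite gt_eqF// sqrtr_gt0 ww0.
  by apply: class_C_sqrt => //; exact: class_C_ip.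
- move=> x i j Ax; rewrite !lt1.
  case: (eqVneq i k) => [->|ik] /=; case: (eqVneq j k) => [->|jk] //=.
  + by move=> _ _; rewrite ipZl ipZr n2.
  + by move=> _ jk'; rewrite ipZl wE// mulr0.
  + by move=> ik' _; rewrite (ipC _ _ (symG x Ax)) ipZl wE// mulr0 ?(negPf ik).
  + exact: oE.
- move=> x i l Ax; rewrite lt1 => ik kl.
  case: eqP ik => [_ _|_ /= ik]; last by rewrite tE// ltnW.
  rewrite !mxE summxE big1 => [|j _]; last by rewrite mxE tE ?mulr0// ltnW.
  have /negPf -> : l != o by rewrite -val_eqE/= gtn_eqF.
  by rewrite andbF subr0 mulr0.
Qed.

Section OrthonormalBasis.
Context (G : 'M[R]_m) (E : 'I_m -> V).
Hypothesis oE : forall i j, ip G (E i) (E j) = (i == j)%:R.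

Local Notation P := (\matrix_i E i).

Lemma orthonormal_mx : P *m G *m P^T = 1%:M.
Proof.
by apply/matrixP => i j; rewrite -ip_row !rowK oE mxE.
Qed.

Lemma orthonormal_mxV : P^T *m (P *m G) = 1%:M.
Proof. exact: mulmx1C orthonormal_mx. Qed.

(** Matrix form of the expansion [v = \sum_j ip G v (E j) *: E j]. *)
Lemma orthonormal_mx_sym : G^T = G -> G *m P^T *m P = 1%:M.
Proof.
move=> sG; apply: trmx_inj; rewrite trmx1 !trmx_mul trmxK sG; exact: orthonormal_mxV.
Qed.

(** The sum is the trace of the matrix of [S] in the basis [E]. *)
Lemma sum_ip_endo (S : 'M[R]_m) : \sum_i ip G (E i) (E i *m S) = \tr S.
Proof.
have -> : \sum_i ip G (E i) (E i *m S) = \tr (P *m G *m (P *m S)^T).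
  by apply: eq_bigr => i _; rewrite -ip_row row_mul rowK.
rewrite trmx_mul mulmxA mxtrace_mulC mulmxA mulmxA -(mulmxA _ P) orthonormal_mxV.
by rewrite mul1mx mxtrace_tr.
Qed.

End OrthonormalBasis.

End Frames.

(** * A hypersurface with its Blaschke structure in one chart *)

Section HypersurfaceChart.
Local Open Scope classical_set_scope.
Local Open Scope ring_scope.
Context {R : realType} {m : nat}.
Local Notation V := 'rV[R]_m.
Local Notation W := 'rV[R]_(m + 1).
Local Notation e_ i := (delta_mx 0 i : 'rV[R]_m).

(** The content of a Blaschke structure in one chart with image [A]: here [F] is the
    local expression of the hypersurface, and [G], [S], [Gam] are the components of
    the metric, of the shape operator and of the induced connection. *)
Record blaschke_chart (A : set V) (F xi : V -> W) (G S : V -> 'M[R]_m)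
    (Gam : christoffel R m) : Prop := BlaschkeChart {
  chart_open : open A ;
  chart_smooth : smooth_on A F ;
  normal_smooth : smooth_on A xi ;
  chart_metric_smooth : smooth_on A G ;
  shape_smooth : smooth_on A S ;
  christoffel_smooth : forall i j, smooth_on A (fun x => Gam x i j) ;
  chart_metric_sym : forall x, A x -> (G x)^T = G x ;
  chart_metric_pos : forall x u, A x -> u != 0 -> 0 < ip (G x) u u ;
  chart_immersion : forall x v, A x -> 'D_v F x = 0 -> v = 0 ;
  normal_transversal : forall x w, A x -> 'D_w F x != xi x ;
  chart_gauss : forall B X Y, open B -> B `<=` A -> smooth_on B X ->
    smooth_on B Y -> forall x, B x ->
    'D_(X x) (push F Y) x
      = 'D_(cov Gam X Y x) F x + ip (G x) (X x) (Y x) *: xi x ;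
  chart_weingarten : forall x u, A x -> 'D_u xi x = - 'D_(u *m S x) F x ;
  chart_volume : forall x (v : 'I_m -> V), A x ->
    let om (w : 'I_m -> V) := \det (col_mx (\matrix_i 'D_(w i) F x) (xi x)) in
    volume_form (G x) om v = om v }.

Context (A : set V) (F xi : V -> W) (G S : V -> 'M[R]_m) (Gam : christoffel R m).
Hypothesis chartP : blaschke_chart A F xi G S Gam.

Let oA := chart_open chartP.
Let sF := chart_smooth chartP.
Let sxi := normal_smooth chartP.
Let sG := chart_metric_smooth chartP.
Let sS := shape_smooth chartP.
Let sGam := christoffel_smooth chartP.
Let symG := chart_metric_sym chartP.
Let posG := chart_metric_pos chartP.
Let immF := chart_immersion chartP.
Let trans_xi := normal_transversal chartP.
Let gauss := chart_gauss chartP.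
Let weingarten := chart_weingarten chartP.
Let volume := chart_volume chartP.

Let dF x : A x -> differentiable F x.
Proof. exact: smooth_differentiable. Qed.

Lemma pushB x a b : A x -> 'D_(a - b) F x = 'D_a F x - 'D_b F x.
Proof. by move=> Ax; rewrite !(deriveE _ (dF Ax)) linearB. Qed.

Lemma push_sum x (I : Type) (r : seq I) (a : I -> V) : A x ->
  'D_(\sum_(i <- r) a i) F x = \sum_(i <- r) 'D_(a i) F x.
Proof.
move=> Ax; rewrite (deriveE _ (dF Ax)) linear_sum.
by apply: eq_bigr => i _; rewrite (deriveE _ (dF Ax)).
Qed.

(** Transversality makes the normal component unique, the immersion property the
    tangential one. *)
Lemma decomposition_inj x a b s t : A x ->
  'D_a F x + s *: xi x = 'D_b F x + t *: xi x -> a = b /\ s = t.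
Proof.
move=> Ax e; have st : s = t.
  apply/eqP/negPn/negP => st.
  have /negP := trans_xi ((t - s)^-1 *: (a - b)) Ax; apply.
  rewrite (deriveZl _ _ (dF Ax)) pushB//.
  have -> : 'D_a F x - 'D_b F x = (t - s) *: xi x.
    by apply/eqP; rewrite subr_eq addrC scalerBl addrA -e addrK.
  by rewrite scalerA mulVf ?scale1r// subr_eq0 eq_sym.
split=> //; apply/eqP; rewrite -subr_eq0; apply/eqP; apply: (immF Ax).
by rewrite pushB//; rewrite st in e; rewrite (addIr _ e) subrr.
Qed.

Lemma gauss_cst x u v : A x ->
  'D_u ('D_v F) x = 'D_(bil (Gam x) u v) F x + ip (G x) u v *: xi x.
Proof.
move=> Ax; have h := gauss oA (@subset_refl _ A) (smooth_on_cst A u)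
  (smooth_on_cst A v) Ax.
have E : cov Gam (cst u) (cst v) x = bil (Gam x) u v by rewrite /cov derive_cst add0r.
by rewrite E in h.
Qed.

(** Tangential part of the symmetry of ['D_u ('D_v F)]. *)
Lemma connection_torsion_free x u v : A x -> bil (Gam x) u v = bil (Gam x) v u.
Proof.
move=> Ax; have h := smooth_schwarz u v oA sF Ax.
have e := etrans (esym (gauss_cst v u Ax)) (etrans h (gauss_cst u v Ax)).
by have [] := decomposition_inj Ax e.
Qed.

Local Notation C := (nabla_metric G Gam).

Lemma derive_metric x u v w : A x ->
  'D_u (fun y => ip (G y) v w) x = ip ('D_u G x) v w.
Proof.
move=> Ax; have dG := smooth_derivable (v := u) sG Ax.
have [_ ->] := is_derive_ip dG (derivable_cst v x u) (derivable_cst w x u).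
by rewrite !derive_cst ip0l ip0r !addr0.
Qed.

(** The tangential part [a] is left unspecified because the Codazzi equation is the
    normal part of the symmetry of third derivatives. *)
Lemma third_derivative x u v w : A x -> exists a,
  'D_u ('D_v ('D_w F)) x = 'D_a F x
    + (ip (G x) u (bil (Gam x) v w) + 'D_u (fun y => ip (G y) v w) x) *: xi x.
Proof.
move=> Ax; pose Y y := bil (Gam y) v w; pose g y := ip (G y) v w.
have sY : smooth_on A Y by exact: smooth_bil.
have sg : smooth_on A g by move=> k; apply: class_C_ip => //; exact: class_C_cst.
have E y : A y -> 'D_v ('D_w F) y = push F Y y + g y *: xi y by exact: gauss_cst.
rewrite (derive_on_open u oA Ax E).
have dpY : derivable (push F Y) x u.
  exact: smooth_derivable (smooth_push oA (@subset_refl _ A) sF sY) Ax.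
have [dgx gx] := is_derive_scale (smooth_derivable (v := u) sg Ax)
  (smooth_derivable (v := u) sxi Ax).
have -> : 'D_u (fun y => push F Y y + g y *: xi y) x
    = 'D_u (push F Y) x + 'D_u (fun y => g y *: xi y) x by exact: deriveD.
rewrite gx weingarten//.
have -> : 'D_u (push F Y) x = _ := gauss oA (@subset_refl _ A) (smooth_on_cst A u) sY Ax.
exists (cov Gam (cst u) Y x - g x *: (u *m S x)).
rewrite pushB// (deriveZl _ _ (dF Ax)) scalerN scalerDl.
by rewrite addrACA.
Qed.

(** Normal part of the symmetry of ['D_u ('D_v ('D_w F))] in [u] and [v].  With
    [nabla_metricC] it makes the cubic form [C] totally symmetric. *)
Lemma codazzi x u v w : A x -> C x u v w = C x v u w.
Proof.
move=> Ax; have [a ea] := third_derivative u v w Ax.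
have [b eb] := third_derivative v u w Ax.
have h := smooth_schwarz v u oA (smooth_derive w sF) Ax.
have [_ e] := decomposition_inj Ax (etrans (esym ea) (etrans h eb)).
rewrite /nabla_metric (connection_torsion_free v u Ax).
move: e; move: (ip _ u _) (ip _ v _) (ip _ _ w) ('D_u _ x) ('D_v _ x).
by move=> a1 a2 a3 a4 a5 e; lra.
Qed.

Lemma nabla_metricC x u v w : A x -> C x u v w = C x u w v.
Proof.
move=> Ax; rewrite /nabla_metric.
have -> : 'D_u (fun y => ip (G y) v w) x = 'D_u (fun y => ip (G y) w v) x.
  by apply: (derive_on_open u oA Ax) => y Ay; exact: ipC (symG Ay).
rewrite (ipC (bil (Gam x) u v) w (symG Ax)) (ipC v (bil (Gam x) u w) (symG Ax)).
by rewrite addrAC.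
Qed.

Lemma nabla_metric_delta x i j l : A x ->
  'D_(e_ i) (fun y => G y j l) x
  = C x (e_ i) (e_ j) (e_ l) + ip (G x) (Gam x i j) (e_ l)
    + ip (G x) (Gam x i l) (e_ j).
Proof.
move=> Ax; rewrite /nabla_metric !bil_delta (ipC (e_ j) _ (symG Ax)) [RHS]addrAC !subrK.
by congr ('D_ _ _ x); apply/funext => y; rewrite ip_delta.
Qed.

Lemma ip_sharp x a i : A x -> ip (G x) (sharp G x a) (e_ i) = a 0 i.
Proof.
move=> Ax; have uG : G x \in unitmx by apply: nondegenerate_unitmx => u; exact: posG.
by rewrite /ip /sharp mulmxKV// trmx_delta -colE mxE.
Qed.

Let GamC x i j : A x -> Gam x i j = Gam x j i.
Proof. by move=> Ax; rewrite -!bil_delta connection_torsion_free. Qed.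

(** For a totally symmetric [C] the Koszul formula collapses to
    [h (K (u, v), w) = - C (u, v, w) / 2]. *)
Lemma ip_difference x i j l : A x ->
  ip (G x) (difference G Gam x i j) (e_ l) = - 2^-1 * C x (e_ i) (e_ j) (e_ l).
Proof.
move=> Ax; rewrite /difference ipDl ipNl ip_sharp// mxE !nabla_metric_delta//.
rewrite (codazzi (e_ j) (e_ i) _ Ax) (codazzi (e_ l) (e_ i) _ Ax).
rewrite (nabla_metricC (e_ i) (e_ l) (e_ j) Ax).
rewrite (GamC j i Ax) (GamC l i Ax) (GamC l j Ax).
by field.
Qed.

Lemma ip_conjugate x i j l : A x ->
  ip (G x) (conjugate G Gam x i j - Gam x i j) (e_ l) = C x (e_ i) (e_ j) (e_ l).
Proof.
move=> Ax; rewrite ipDl ipNl ip_sharp// mxE nabla_metric_delta//.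
by rewrite (nabla_metricC (e_ i) (e_ l) (e_ j) Ax) [LHS]addrAC !addrK.
Qed.

Lemma nabla_metric_linear x (I : Type) (r : seq I) (a : I -> R) (u : I -> V) v w :
  A x -> C x (\sum_(i <- r) a i *: u i) v w = \sum_(i <- r) a i * C x (u i) v w.
Proof.
move=> Ax; have dg : differentiable (fun y => ip (G y) v w) x.
  apply: (@smooth_differentiable _ _ _ A) Ax => k.
  by apply: class_C_ip => //; exact: class_C_cst.
have CD b y z : C x (b *: y + z) v w = b * C x y v w + C x z v w.
  rewrite /nabla_metric !bilDl !bilZl ipDl ipDr ipZl ipZr.
  rewrite (deriveDl _ _ dg) (deriveZl _ _ dg) -[_ *: 'D_y _ x]/(_ * _).
  by ring.
elim: r => [|i r IH]; last by rewrite !big_cons CD IH.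
rewrite !big_nil; have := CD 1 0 0; rewrite scaler0 addr0 mul1r => h.
by apply: (@addrI _ (C x 0 v w)); rewrite addr0 -h.
Qed.

Lemma nabla_metric_components x u v w : A x ->
  C x u v w = \sum_i \sum_j u 0 i * v 0 j * C x (e_ i) (e_ j) w.
Proof.
move=> Ax; rewrite {1}(row_sum_delta u) nabla_metric_linear//.
apply: eq_bigr => i _; rewrite codazzi// {1}(row_sum_delta v) nabla_metric_linear//.
rewrite mulr_sumr; apply: eq_bigr => j _.
by rewrite (codazzi (e_ j) (e_ i) w Ax) mulrA.
Qed.

(** Extends an identity between components to arbitrary vectors in the two slots
    which are traced over a frame. *)
Lemma ip_bil_nabla_metric x a (T : 'I_m -> 'I_m -> V) : A x ->
  (forall i j l, ip (G x) (T i j) (e_ l) = a * C x (e_ i) (e_ j) (e_ l)) ->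
  forall u v l, ip (G x) (bil T u v) (e_ l) = a * C x u v (e_ l).
Proof.
move=> Ax hT u v l; rewrite nabla_metric_components// mulr_sumr ip_suml.
apply: eq_bigr => i _; rewrite mulr_sumr ip_suml; apply: eq_bigr => j _.
by rewrite ipZl hT mulrCA.
Qed.

Lemma ip_delta_eq0 x u : A x -> (forall l, ip (G x) u (e_ l) = 0) -> u = 0.
Proof.
move=> Ax h; apply/eqP/negPn/negP => u0; have := posG Ax u0.
rewrite {2}(row_sum_delta u) ip_sumr big1 ?ltxx// => l _.
by rewrite ipZr h mulr0.
Qed.

(** * Apolarity *)

Section Frame.
Context (B : set V) (E : 'I_m -> V -> V).
Hypothesis oB : open B.
Hypothesis BA : B `<=` A.
Hypothesis fE : orthonormal_frame G B E.

Let sE i : smooth_on B (E i). Proof. by have [h _] := fE. Qed.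
Let oE x : B x -> forall i j, ip (G x) (E i x) (E j x) = (i == j)%:R.
Proof. by have [_ h] := fE; exact: h. Qed.

Let frame_mx y := col_mx (\matrix_i 'D_(E i y) F y) (xi y).

(** A linear relation between the rows is a relation between the tangent vectors
    [f_* E i] and [xi]. *)
Lemma det_frame_neq0 x : B x -> \det (frame_mx x) != 0.
Proof.
move=> Bx; have Ax := BA Bx; apply/negP => /det0P[r r0].
have JE v : 'D_v F x = v *m jacobian F x := deriveEjacobian v (dF Ax).
have -> : frame_mx x = col_mx ((\matrix_i E i x) *m jacobian F x) (xi x).
  congr col_mx; apply/row_matrixP => i.
  by rewrite rowK row_mul rowK JE.
rewrite -(hsubmxK r) mul_row_col mulmxA -JE => h.
set a := lsubmx r *m _ in h; set b := rsubmx r in h.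
have e : 'D_a F x + b 0 0 *: xi x = 'D_0 F x + 0 *: xi x.
  by rewrite derive0 scale0r addr0 -mul_scalar_mx -mx11_scalar.
have [a0 b0] := decomposition_inj Ax e.
have rr0 : rsubmx r = 0.
  by rewrite -/b (mx11_scalar b) b0; apply/matrixP => i j; rewrite !mxE mul0rn.
have lr0 : lsubmx r = 0.
  have PGP := orthonormal_mx (oE Bx).
  by rewrite -[lsubmx r]mulmx1 -PGP !mulmxA -/a a0 !mul0mx.
have rE : r = row_mx 0 0 by rewrite -lr0 -rr0 hsubmxK.
by move: r0; rewrite rE row_mx0 eqxx.
Qed.

Let N u x i := cov Gam (cst u) (E i) x.

(** Structure equations: by the Gauss and Weingarten formulas the derivative of each
    row is a combination of the rows.  The upper left block holds the coefficients
    of [nabla_u E i] along the frame; the lower right one is [0] because [D xi] is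
    tangential. *)
Lemma derive_frame_mx x u : B x -> is_derive x u frame_mx
  (block_mx ((\matrix_i N u x i) *m G x *m (\matrix_i E i x)^T)
            (\matrix_(i < m, j < 1) ip (G x) u (E i x))
            (- (u *m S x) *m G x *m (\matrix_i E i x)^T) 0 *m frame_mx x).
Proof.
move=> Bx; have Ax := BA Bx.
have JE v : 'D_v F x = v *m jacobian F x := deriveEjacobian v (dF Ax).
set P := \matrix_i E i x; set J := jacobian F x in JE.
have PJ : \matrix_i 'D_(E i x) F x = P *m J.
  by apply/row_matrixP => i; rewrite rowK row_mul rowK JE.
have GPP : G x *m P^T *m P = 1%:M := orthonormal_mx_sym (oE Bx) (symG Ax).
(* [G P^T P = 1] turns the coefficients along the frame back into vectors. *)
rewrite mul_block_col PJ -!(mulmxA _ P^T) !(mulmxA _ P).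
rewrite -!(mulmxA _ (G x)) !(mulmxA (G x)).
rewrite GPP !mul1mx mul0mx addr0.
apply: is_derive_mx => i j; case: (split_ordP i) => k ->.
  rewrite col_mxEu (_ : (fun y => _) = (fun y => push F (E k) y 0 j)); last first.
    by apply/funext => y; rewrite col_mxEu mxE.
  have dp : derivable (push F (E k)) x u.
    exact: smooth_derivable (smooth_push oB BA sF (sE k)) Bx.
  apply: DeriveDef; first exact: (derivable_mxP _ _ _).1 dp 0 j.
  rewrite (derive_coord 0 j dp).
  rewrite (gauss oB BA (smooth_on_cst B u) (sE k) Bx) JE.
  rewrite ![in RHS]mxE ![in LHS]mxE big_ord1 !mxE; congr (_ + _).
  by apply: eq_bigr => l _; rewrite !mxE.
rewrite col_mxEd (_ : (fun y => _) = (fun y => xi y k j)); last first.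
  by apply/funext => y; rewrite col_mxEd.
have dxi : derivable xi x u := smooth_derivable (v := u) sxi Ax.
apply: DeriveDef; first exact: (derivable_mxP _ _ _).1 dxi k j.
by rewrite (derive_coord k j dxi) weingarten// JE mulNmx.
Qed.

(** The Gram matrix of an orthonormal frame is the identity, so the volume condition
    says that the determinant equals its own sign. *)
Lemma det_frame_sqr x : B x -> \det (frame_mx x) * \det (frame_mx x) = 1.
Proof.
move=> Bx; have := volume (E^~ x) (BA Bx); rewrite /volume_form.
rewrite (_ : \matrix_(i, j) _ = 1%:M); last first.
  by apply/matrixP => i j; rewrite !mxE oE.
rewrite det1 sqrtr1 mulr1 => <-.
by rewrite -expr2 sqr_sg det_frame_neq0.
Qed.

(** The determinant of the frame is locally constant, so by Jacobi's formula the
    matrix of the structure equations has trace zero. *)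
Lemma apolarity x u : B x -> \sum_i ip (G x) (N u x i) (E i x) = 0.
Proof.
move=> Bx; have [dB eB] := derive_frame_mx u Bx.
have [dd ed] := is_derive_det dB.
have : 'D_u (fun y => \det (frame_mx y) * \det (frame_mx y)) x = 0.
  rewrite (derive_on_open u oB Bx (G := (cst 1 : V -> R))); first exact: derive_cst.
  exact: det_frame_sqr.
have [_ ->] := is_deriveM (derivableP dd) (derivableP dd).
rewrite ed eB -(mulmxA _ (frame_mx x)) mul_mx_adj mul_mx_scalar mxtraceZ.
rewrite -[_ *: _]/(_ * _).
rewrite mxtrace_block mxtrace0 addr0 => /eqP.
rewrite -mulr2n mulrn_eq0 /= !mulf_eq0 !(negPf (det_frame_neq0 Bx)) /= => /eqP h.
by rewrite -[RHS]h; apply: eq_bigr => i _; rewrite -ip_row !rowK.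
Qed.

(** Differentiating [h (E i, E i) = 1] expresses [C (u, E i, E i)] as
    [- 2 h (nabla_u E i, E i)]. *)
Lemma trace_nabla_metric x u : B x -> \sum_i C x u (E i x) (E i x) = 0.
Proof.
move=> Bx; have Ax := BA Bx.
have h i : C x u (E i x) (E i x) = - 2 * ip (G x) (N u x i) (E i x).
  have [_ e] := is_derive_ip (smooth_derivable (v := u) sG Ax)
    (smooth_derivable (v := u) (sE i) Bx) (smooth_derivable (v := u) (sE i) Bx).
  have e0 : 'D_u (fun y => ip (G y) (E i y) (E i y)) x = 0.
    rewrite (derive_on_open u oB Bx (G := (cst 1 : V -> R))); first exact: derive_cst.
    by move=> y By; rewrite oE// eqxx.
  rewrite e0 in e; rewrite /nabla_metric derive_metric//.
  rewrite /N /cov ipDl (ipC (E i x) _ (symG Ax)).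
  rewrite (ipC (E i x) _ (symG Ax)) in e.
  move: e; move: (ip _ _ _) (ip _ _ _) (ip _ _ _) => a1 a2 a3 e; lra.
by rewrite (eq_bigr _ (fun i _ => h i)) -mulr_sumr apolarity// mulr0.
Qed.

Lemma trace_nabla_metricr x w : B x -> \sum_i C x (E i x) (E i x) w = 0.
Proof.
move=> Bx; have Ax := BA Bx; rewrite -[RHS](trace_nabla_metric w Bx).
by apply: eq_bigr => i _; rewrite nabla_metricC// codazzi.
Qed.

(** Serves both for the difference tensor and for the conjugate connection minus the
    connection, which are multiples of [C] with an index raised. *)
Lemma trace_bil_eq0 x a (T : 'I_m -> 'I_m -> V) : B x ->
  (forall i j l, ip (G x) (T i j) (e_ l) = a * C x (e_ i) (e_ j) (e_ l)) ->
  \sum_i bil T (E i x) (E i x) = 0.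
Proof.
move=> Bx hT; have Ax := BA Bx; apply: (ip_delta_eq0 Ax) => l.
rewrite ip_suml (eq_bigr _ (fun i _ => ip_bil_nabla_metric Ax hT _ _ l)).
by rewrite -mulr_sumr trace_nabla_metricr// mulr0.
Qed.

Lemma trace_K_eq0 x : B x -> trace_K G Gam E x = 0.
Proof.
move=> Bx; apply: (trace_bil_eq0 Bx (a := - 2^-1)) => i j l.
by rewrite ip_difference//; exact: BA.
Qed.

Lemma trace_conjugate x : B x ->
  \sum_i bil (conjugate G Gam x) (E i x) (E i x) = \sum_i bil (Gam x) (E i x) (E i x).
Proof.
move=> Bx; apply/eqP; rewrite -subr_eq0 -sumrB; apply/eqP.
rewrite -[RHS](trace_bil_eq0 (a := 1) Bx
  (T := fun i j => conjugate G Gam x i j - Gam x i j)) => [|i j l].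
  by apply: eq_bigr => i _; rewrite bilB.
by rewrite mul1r ip_conjugate//; exact: BA.
Qed.

(** * Tension and bitension *)

Local Notation flat := (fun (_ : W) (_ _ : 'I_(m + 1)) => 0 : W).

(** By the Gauss formula the [i]-th term is [h (E i, E i) xi = xi]. *)
Lemma tension_blaschke x : B x -> tension Gam flat F E x = m%:R *: xi x.
Proof.
move=> Bx; rewrite /tension.
rewrite (eq_bigr (fun=> xi x)) => [|i _].
  by rewrite sumr_const card_ord scaler_nat.
rewrite /cov_along bil0 addr0 (gauss oB BA (sE i) (sE i) Bx) oE// eqxx.
by rewrite scale1r addrC addKr.
Qed.

Let derive_tension y v : B y ->
  'D_v (tension Gam flat F E) y = - m%:R *: 'D_(v *m S y) F y.
Proof.
move=> By; rewrite (derive_on_open v oB By tension_blaschke).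
have dxi : derivable xi y v := smooth_derivable (v := v) sxi (BA By).
by rewrite (deriveZ _ dxi) weingarten ?scalerN ?scaleNr//; exact: BA.
Qed.

Lemma divergence_trace_K x : B x -> divergence G (trace_K G Gam E) x = 0.
Proof.
move=> Bx; apply: big1 => k _; rewrite /cov trace_K_eq0//.
by rewrite (derive_on_open _ oB Bx (G := cst 0) trace_K_eq0) derive_cst add0r bil0r mxE.
Qed.

(** The Weingarten formula gives the first derivative of [xi], the Gauss formula the
    second one.  The conjugate connection enters through the sum over [i] of its
    values on [(E i, E i)], where [trace_conjugate] replaces it by [Gam]. *)
Lemma rough_laplacian_tension x : B x ->
  rough_laplacian (conjugate G Gam) flat F E (tension Gam flat F E) x =
  - m%:R *: ('D_(trace_nabla Gam S E x) F x + \tr (S x) *: xi x).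
Proof.
move=> Bx; have Ax := BA Bx; rewrite /rough_laplacian.
pose Y i y := E i y *m S y.
have sY i : smooth_on B (Y i).
  move=> k; apply: class_C_mulmx => //; first exact: sE.
  by apply: class_C_sub BA _; exact: sS.
have h i : cov_along flat F (E i) (cov_along flat F (E i) (tension Gam flat F E)) x
    - cov_along flat F (cov (conjugate G Gam) (E i) (E i)) (tension Gam flat F E) x
  = - m%:R *: ('D_(cov Gam (E i) (Y i) x
                  - cov (conjugate G Gam) (E i) (E i) x *m S x) F x
               + ip (G x) (E i x) (E i x *m S x) *: xi x).
  rewrite {1}/cov_along [in X in _ - X]/cov_along !bil0 !addr0 derive_tension//.
  have e y : B y -> cov_along flat F (E i) (tension Gam flat F E) y
      = - m%:R *: push F (Y i) y.
    by move=> By; rewrite /cov_along bil0 addr0 derive_tension.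
  rewrite (derive_on_open _ oB Bx e).
  have dp : derivable (push F (Y i)) x (E i x).
    exact: smooth_derivable (smooth_push oB BA sF (sY i)) Bx.
  rewrite (deriveZ _ dp) (gauss oB BA (sE i) (sY i) Bx) pushB// -scalerBr.
  by rewrite addrAC.
rewrite (eq_bigr _ (fun i _ => h i)) -scaler_sumr big_split /= -scaler_suml.
congr (_ *: (_ + _ *: _)); last exact: (sum_ip_endo (oE Bx) (S x)).
apply: etrans (esym (push_sum _ _ Ax)) _; congr ('D_ _ F x).
rewrite /trace_nabla !sumrB -!mulmx_suml; congr (_ - _ *m _).
by rewrite /cov !big_split /= trace_conjugate.
Qed.

Lemma interchange_flat (GN : W -> 'M[R]_(m + 1)) y z w v :
  Defs.interchange GN flat y z w v = 0.
Proof.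
have cov0 (a b : W) : cov flat (cst a) (cst b) = cst 0.
  by apply/funext => p; rewrite /cov derive_cst bil0 addr0.
have lie0 (a b : W) : lie (cst a) (cst b) = cst 0.
  by apply/funext => p; rewrite /lie !derive_cst subrr.
rewrite /Defs.interchange /sharp (_ : \row_l _ = 0) ?mul0mx//.
apply/matrixP => i l; rewrite !mxE /curvature !cov0 lie0 cov0.
by rewrite /cst !subrr ip0l.
Qed.

(** The divergence term is zero by apolarity and the terms of the target are zero by
    flatness; the rough Laplacian is left. *)
Lemma bitension_blaschke (GN : W -> 'M[R]_(m + 1)) x :
  (forall y i j, levi_civita GN y i j = 0) ->
  conjugate GN flat = flat -> B x ->
  bitension G Gam GN flat F E x =
  - m%:R *: ('D_(trace_nabla Gam S E x) F x + \tr (S x) *: xi x).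
Proof.
move=> LC0 conj0 Bx; rewrite /bitension conj0 rough_laplacian_tension//.
rewrite divergence_trace_K// scale0r addr0 big1 ?subr0 => [|i _]; last first.
  exact: interchange_flat.
rewrite (_ : difference GN flat (F x) = fun _ _ => 0) ?bil0 ?subr0//.
by apply/funext => i; apply/funext => j; rewrite /difference LC0 subrr.
Qed.

End Frame.

End HypersurfaceChart.

(** * Euclidean metrics *)

Section FlatMetric.
Local Open Scope classical_set_scope.
Local Open Scope ring_scope.
Context {R : realType} {n : nat}.
Local Notation W := 'rV[R]_n.
Local Notation e_ i := (delta_mx 0 i : 'rV[R]_n).
Local Notation flat := (fun (_ : W) (_ _ : 'I_n) => 0 : W).
Context (G : W -> 'M[R]_n).
Hypothesis sG : smooth_on setT G.
Hypothesis symG : forall x, (G x)^T = G x.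
Hypothesis uG : forall x, G x \in unitmx.
Hypothesis LC0 : forall x i j, levi_civita G x i j = 0.

(** The Koszul formulas for [(i, j, l)] and [(i, l, j)] add up to the derivative in
    direction [i], so a metric with zero Christoffel symbols is constant. *)
Lemma levi_civita0_derive x i j l : 'D_(e_ i) (fun y => G y j l) x = 0.
Proof.
have sym a b : (fun y => G y a b) = (fun y => G y b a).
  by apply/funext => y; rewrite -{1}symG mxE.
have K a b c : 'D_(e_ a) (fun y => G y b c) x + 'D_(e_ b) (fun y => G y a c) x
    - 'D_(e_ c) (fun y => G y a b) x = 0.
  have := congr1 (fun v : W => (v *m G x) 0 c) (LC0 x a b).
  rewrite /levi_civita /sharp mulmxKV// mul0mx !mxE => /eqP.
  by rewrite mulf_eq0 invr_eq0 pnatr_eq0 => /eqP.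
have := K i j l; have := K i l j; rewrite (sym l j).
move: ('D_(e_ i) _ x) ('D_(e_ j) _ x) ('D_(e_ l) _ x) => a b c h1 h2; lra.
Qed.

Lemma levi_civita0_conjugate : conjugate G flat = flat.
Proof.
apply/funext => x; apply/funext => i; apply/funext => j.
rewrite /conjugate /sharp (_ : \row_l _ = 0) ?mul0mx//.
by apply/matrixP => k l; rewrite !mxE levi_civita0_derive ip0l subr0.
Qed.

Lemma levi_civita0_nabla_metric x u v w : nabla_metric G flat x u v w = 0.
Proof.
have dG : differentiable G x by exact: smooth_differentiable sG I.
have dG0 : 'D_u G x = 0.
  rewrite (row_sum_delta u) (deriveE _ dG) linear_sum big1// => i _.
  rewrite linearZ /= -(deriveE _ dG) (_ : 'D_(e_ i) G x = 0) ?scaler0//.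
  apply/matrixP => j l; rewrite mxE -(levi_civita0_derive x i j l).
  exact: diff_coord dG.
have [_ e] := is_derive_ip (diff_derivable (v := u) dG)
  (derivable_cst v x u) (derivable_cst w x u).
rewrite /nabla_metric e dG0 !derive_cst !bil0 !ip0l !ip0r.
by rewrite /ip mulmx0 mul0mx mxE !addr0 !subr0.
Qed.

End FlatMetric.

(** * From charts to the manifold *)

Section BlaschkeStructure.
Local Open Scope classical_set_scope.
Local Open Scope ring_scope.
Context {R : realType} {m : nat} {M : manifold R m}.
Context (f : M -> Rspace R (m + 1)) (xi : M -> 'rV[R]_(m + 1)).
Context (h : metric M) (nab : connection M) (S : endo_field M).
Hypothesis immf : immersion f.
Hypothesis hxi : blaschke_structure f xi h nab S.

Let img_local_dom c d : img c `<=` local_dom f c d.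
Proof. by case: d => x Ax; split. Qed.

Lemma blaschke_structure_chart c :
  blaschke_chart (img c) (Frep f c) (sec_rep xi c) (h c) (S c) (nab c).
Proof.
have [[_ smf] imm] := immf; have [sxi txi gf [theta [wf theta0]] vol] := hxi.
split.
- exact: cimg_open.
- by move=> k; apply: class_C_sub (smf c tt k); exact: img_local_dom.
- exact: sxi.
- exact: gmat_smooth.
- exact: emat_smooth.
- by move=> i j; exact: gam_smooth.
- by move=> x; exact: gmat_sym.
- by move=> x u; exact: gmat_pos.
- by move=> x v Ax; apply: (imm c tt); exact: img_local_dom.
- by move=> x w; exact: txi.
- move=> B X Y oB BA sX sY x Bx; have := gf c B X Y oB BA sX sY x Bx.
  by rewrite /cov_along bil0 addr0.
- move=> x u Ax; have oA : open (img c) by exact: cimg_open.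
  have := wf c _ _ oA (@subset_refl _ _) (smooth_on_cst (img c) u) x Ax.
  by rewrite /cov_along bil0 addr0 theta0// mulmx0 mxE scale0r addr0.
- by move=> x v Ax; exact: vol.
Qed.

Lemma blaschke_statistical : statistical h nab.
Proof.
split=> [c x u v Ax|c x u v w Ax].
  exact: (connection_torsion_free (blaschke_structure_chart c) u v Ax).
exact: (codazzi (blaschke_structure_chart c) u v w Ax).
Qed.

Lemma blaschke_tension_nonvanishing : (0 < m)%N ->
  tension_nonvanishing h nab (flat_connection R (m + 1)) f.
Proof.
move=> m0 c [] B E oB BA oE x Bx.
have BA' : B `<=` img c by move=> y /BA [].
rewrite [X in X != 0](tension_blaschke (blaschke_structure_chart c) oB BA' oE Bx).
rewrite scaler_eq0 pnatr_eq0 negb_or -lt0n m0 /=.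
have := normal_transversal (blaschke_structure_chart c) 0 (BA' x Bx).
by rewrite derive0 eq_sym.
Qed.

Context (g0 : metric (Rspace R (m + 1))).
Hypothesis LC0 : forall x i j, levi_civita (g0 tt) x i j = 0.

Let img_Rspace (x : 'rV[R]_(m + 1)) : img (M := Rspace R (m + 1)) tt x.
Proof. by exists x. Qed.

Let s0 : smooth_on setT (g0 tt).
Proof. by move=> k; apply: class_C_sub (gmat_smooth g0 tt k). Qed.
Let sym0 x : (g0 tt x)^T = g0 tt x.
Proof. exact/gmat_sym/img_Rspace. Qed.
Let unit0 x : g0 tt x \in unitmx.
Proof. by apply: nondegenerate_unitmx => u; exact/gmat_pos/img_Rspace. Qed.

Lemma flat_statistical : statistical g0 (flat_connection R (m + 1)).
Proof.
split=> [[] x u v _|[] x u v w _]; first by rewrite !bil0.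
by rewrite !(levi_civita0_nabla_metric s0 sym0 unit0 LC0).
Qed.

Lemma bitension_eq0 (m0 : (0 < m)%N) c B E x :
  open B -> B `<=` img c -> orthonormal_frame (h c) B E -> B x ->
  bitension (h c) (nab c) (g0 tt) (flat_connection R (m + 1) tt)
    (Frep f c) E x = 0 <->
  trace_nabla (nab c) (S c) E x = 0 /\ \tr (S c x) = 0.
Proof.
move=> oB BA oE Bx; have cP := blaschke_structure_chart c.
have e := bitension_blaschke cP oB BA oE LC0
  (levi_civita0_conjugate sym0 unit0 LC0) Bx.
have mN0 : (- m%:R : R) != 0 by rewrite oppr_eq0 pnatr_eq0 -lt0n.
split=> [b0|[t0 tr0]]; last first.
  by apply: etrans e _; rewrite t0 tr0 derive0 scale0r addr0 scaler0.
have /eqP := etrans (esym e) b0.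
rewrite scaler_eq0 (negPf mN0) /= => /eqP d0.
apply: (decomposition_inj cP (BA x Bx)).
by rewrite d0 derive0 scale0r addr0.
Qed.

(** In the direct implication the frame of a given point comes from Gram-Schmidt on
    the whole chart. *)
Lemma blaschke_biharmonicP (m0 : (0 < m)%N) :
  statistical_biharmonic h nab g0 (flat_connection R (m + 1)) f <->
  trace_free S /\ trace_nabla_zero h nab S.
Proof.
split=> [[_ _ _ bz]|[tf tz]].
  split=> [c x Ax|c B E oB BA oE x Bx].
    have cP := blaschke_structure_chart c.
    have [E oE] := orthonormal_frame_exists (chart_open cP) (chart_metric_smooth cP)
      (chart_metric_sym cP) (chart_metric_pos cP).
    have b0 := bz c tt _ E (chart_open cP) (@img_local_dom c tt) oE x Ax.
    by have [] := (bitension_eq0 m0 (chart_open cP) (@subset_refl _ _) oE Ax).1 b0.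
  have b0 := bz c tt B E oB (subset_trans BA (@img_local_dom c tt)) oE x Bx.
  by have [] := (bitension_eq0 m0 oB BA oE Bx).1 b0.
split; [exact: blaschke_statistical|exact: flat_statistical|exact: immf.1|].
move=> c [] B E oB BA oE x Bx; have BA' : B `<=` img c by move=> y /BA [].
apply/(bitension_eq0 m0 oB BA' oE Bx); split; first exact: tz oE x Bx.
by apply: tf; exact: BA'.
Qed.

Lemma endo_zero_trace_free : endo_zero S -> trace_free S.
Proof. by move=> S0 c x Ax; rewrite S0// mxtrace0. Qed.

Lemma endo_zero_trace_nabla_zero : endo_zero S -> trace_nabla_zero h nab S.
Proof.
move=> S0 c B E oB BA oE x Bx; apply: big1 => i _.
have ES0 y : B y -> E i y *m S c y = cst 0 y.
  by move=> By; rewrite S0 ?mulmx0//; exact: BA.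
rewrite (S0 c x (BA x Bx)) mulmx0 subr0 /cov (derive_on_open _ oB Bx ES0).
by rewrite derive_cst add0r ES0// bil0r.
Qed.

End BlaschkeStructure.

Theorem theorem4p5 (R : realType) (m : nat) (hm : (2 <= m)%N)
  (M : manifold R m) (f : M -> Rspace R (m + 1))
  (hf : locally_strongly_convex f)
  (xi : M -> 'rV[R]_(m + 1)) (h : metric M) (nab : connection M)
  (S : endo_field M) (hxi : blaschke_structure f xi h nab S)
  (g0 : metric (Rspace R (m + 1))) (hg0 : compatible_metric g0) :
  tension_nonvanishing h nab (flat_connection R (m + 1)) f /\
  (statistical_biharmonic h nab g0 (flat_connection R (m + 1)) f <->
     trace_free S /\ trace_nabla_zero h nab S) /\
  (endo_zero S ->
     statistical_biharmonic h nab g0 (flat_connection R (m + 1)) f).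
Proof.
have m0 : (0 < m)%N by exact: ltnW.
have [immf _] := hf; have [LC0 _] := hg0.
have biharmonicP := blaschke_biharmonicP immf hxi LC0 m0.
split; first exact: blaschke_tension_nonvanishing immf hxi m0.
split=> // S0; apply/biharmonicP; split.
  exact: endo_zero_trace_free.
exact: endo_zero_trace_nabla_zero.
Qed.
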